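(* Let $L$ be a visibly pushdown language over a pushdown alphabet $(\Sigma_c,\Sigma_r,\Sigma_{\mathit{int}})$ with $\Sigma_c\neq\emptyset$ and $\Sigma_r\neq\emptyset$, and let $V_L(n)$ be its space complexity in the variable-size sliding window model. Then exactly one of the following holds: $V_L(n)\in O(1)$; $V_L(n)\in\Theta(\log n)$; or $V_L(n)\in O(n)$ and $V_L(n)\notin o(n)$.
   Context: A pushdown alphabet is a triple of pairwise disjoint finite alphabets $\Sigma_c$ (call letters), $\Sigma_r$ (return letters), $\Sigma_{\mathit{int}}$ (internal letters); put $\Sigma=\Sigma_c\cup\Sigma_r\cup\Sigma_{\mathit{int}}$. A (deterministic) visibly pushdown automaton (VPA) is $A=(Q,\Sigma,\Gamma,\bot,q_0,\delta,F)$ with finite state set $Q$, finite stack alphabet $\Gamma\ni\bot$, initial state $q_0$, final states $F\subseteq Q$, and transition functions $\delta_c:Q\times\Sigma_c\to(\Gamma\setminus\{\bot\})\times Q$, $\delta_r:Q\times\Sigma_r\times\Gamma\to Q$, $\delta_{\mathit{int}}:Q\times\Sigma_{\mathit{int}}\to Q$. Configurations are words $\alpha q$ with $\alpha\in\bot(\Gamma\setminus\{\bot\})^*$, $q\in Q$. On a call letter $a$ with $\delta(p,a)=(\gamma,q)$: $\alpha p\mapsto\alpha\gamma q$; on an internal letter $a$ with $\delta(p,a)=q$: $\alpha p\mapsto \alpha q$; on a return letter $a$: $\alpha\gamma p\mapsto\alpha\,\delta(p,a,\gamma)$ if $\gamma\neq\bot$, and $\bot p\mapsto\bot\,\delta(p,a,\bot)$.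 $A$ accepts $w$ if the configuration reached from $\bot q_0$ on $w$ has its state in $F$; a visibly pushdown language is a language accepted by some VPA. Variable-size sliding window model: let $\overline\Sigma=\Sigma\cup\{\downarrow\}$. The active window $\mathrm{wnd}(u)\in\Sigma^*$ for $u\in\overline\Sigma^*$ is defined by $\mathrm{wnd}(\varepsilon)=\varepsilon$, $\mathrm{wnd}(ua)=\mathrm{wnd}(u)a$ for $a\in\Sigma$, $\mathrm{wnd}(u\downarrow)=\varepsilon$ if $\mathrm{wnd}(u)=\varepsilon$, and $\mathrm{wnd}(u\downarrow)=v$ if $\mathrm{wnd}(u)=av$ with $a\in\Sigma$. A variable-size sliding window algorithm for $L$ is a deterministic (possibly infinite-state) automaton over $\overline\Sigma$ whose states are encoded by bit strings and which, after reading each prefix $a_1\cdots a_t$ of its input, outputs whether $\mathrm{wnd}(a_1\cdots a_t)\in L$. Its space complexity at $n$ is the maximum length of the bit strings of states reached on inputs $a_1\cdots a_m$ with $|\mathrm{wnd}(a_1\cdots a_t)|\le n$ for all $0\le t\le m$. $V_L(n)$ denotes the space complexity of a space-optimal such algorithm (one whose space complexity is pointwise minimal; such an algorithm exists). Here $\log n=\lfloor\log_2 n\rfloor$. *)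

(* Defs.v *)
From mathcomp Require Import all_boot.
Set Implicit Arguments. Unset Strict Implicit. Unset Printing Implicit Defensive.

(* A pushdown alphabet is a finite type Sigma together with a function
   classifying each letter as a call, return or internal letter; this is
   exactly a partition of Sigma into the three pairwise disjoint finite
   alphabets Sigma_c, Sigma_r, Sigma_int. *)
Inductive letter_kind := Call | Ret | Int.

(* Configuration alpha q with alpha in bot (Gamma\{bot})^* is represented by
   (s, q) where s : seq Gam lists the non-bottom stack symbols, top first;
   the bottom symbol bot is implicit. *)
Definition vpa_step (Sigma Q Gam : Type) (kind : Sigma -> letter_kind) (bot : Gam)
    (dc : Q -> Sigma -> Gam * Q) (dr : Q -> Sigma -> Gam -> Q) (di : Q -> Sigma -> Q)
    (c : seq Gam * Q) (a : Sigma) : seq Gam * Q :=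
  let: (s, p) := c in
  match kind a with
  | Call => let: (g, q) := dc p a in (g :: s, q)
  | Int => (s, di p a)
  | Ret => match s with
           | [::] => ([::], dr p a bot)
           | g :: s' => (s', dr p a g)
           end
  end.

Definition vpa_run (Sigma Q Gam : Type) (kind : Sigma -> letter_kind) (bot : Gam)
    (q0 : Q) dc dr di (w : seq Sigma) : seq Gam * Q :=
  foldl (@vpa_step Sigma Q Gam kind bot dc dr di) ([::], q0) w.

(* L is a visibly pushdown language over the pushdown alphabet (Sigma, kind):
   it is accepted by some (deterministic) VPA with finite state set Q, finite
   stack alphabet Gam containing bot, where call transitions only push
   non-bottom symbols.  Transition functions are given on all of Sigma but
   only used on letters of the appropriate kind. *)
Definition is_vpl (Sigma : finType) (kind : Sigma -> letter_kind)
    (L : seq Sigma -> bool) : Prop :=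
  exists (Q Gam : finType) (bot : Gam) (q0 : Q)
         (dc : Q -> Sigma -> Gam * Q) (dr : Q -> Sigma -> Gam -> Q)
         (di : Q -> Sigma -> Q) (F : pred Q),
    (forall q a, kind a = Call -> (dc q a).1 != bot) /\
    (forall w, L w = F (vpa_run kind bot q0 dc dr di w).2).

Definition wnd_step (Sigma : Type) (w : seq Sigma) (x : option Sigma) : seq Sigma :=
  match x with
  | Some a => rcons w a
  | None => behead w
  end.

Definition wnd (Sigma : Type) (u : seq (option Sigma)) : seq Sigma :=
  foldl (@wnd_step Sigma) [::] u.

Record sw_alg (Sigma : Type) := SwAlg {
  sw_init : seq bool;
  sw_trans : seq bool -> option Sigma -> seq bool;
  sw_out : seq bool -> bool }.

Definition sw_run (Sigma : Type) (A : sw_alg Sigma) (u : seq (option Sigma)) : seq bool :=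
  foldl (sw_trans A) (sw_init A) u.

Definition sw_correct (Sigma : Type) (L : seq Sigma -> bool) (A : sw_alg Sigma) : Prop :=
  forall u : seq (option Sigma), sw_out A (sw_run A u) = L (wnd u).

Definition sw_space_le (Sigma : Type) (A : sw_alg Sigma) (n s : nat) : Prop :=
  forall u : seq (option Sigma),
    (forall t, t <= size u -> size (wnd (take t u)) <= n) ->
    size (sw_run A u) <= s.

(* V is the space complexity V_L of a space-optimal sliding window algorithm
   for L, i.e. the pointwise minimum over all sliding window algorithms for L
   of their space complexity. *)
Definition is_VL (Sigma : Type) (L : seq Sigma -> bool) (V : nat -> nat) : Prop :=
  forall n,
    (exists A : sw_alg Sigma, sw_correct L A /\ sw_space_le A n (V n)) /\
    (forall (A : sw_alg Sigma) s, sw_correct L A -> sw_space_le A n s -> V n <= s).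

Definition log2 (n : nat) : nat := trunc_log 2 n.

Definition bigO1 (f : nat -> nat) : Prop :=
  exists C N, forall n, N <= n -> f n <= C.

Definition bigO_log (f : nat -> nat) : Prop :=
  exists C N, forall n, N <= n -> f n <= C * log2 n.

Definition bigOmega_log (f : nat -> nat) : Prop :=
  exists C N, forall n, N <= n -> log2 n <= C * f n.

Definition bigTheta_log (f : nat -> nat) : Prop := bigO_log f /\ bigOmega_log f.

Definition bigO_lin (f : nat -> nat) : Prop :=
  exists C N, forall n, N <= n -> f n <= C * n.

Definition littleo_lin (f : nat -> nat) : Prop :=
  forall k, 0 < k -> exists N, forall n, N <= n -> k * f n <= n.

(* Main.v *)
Require Import Defs.
From mathcomp Require Import all_boot.
From mathcomp Require Import boolp zify.

Set Implicit Arguments. Unset Strict Implicit. Unset Printing Implicit Defensive.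

(** Up to rounding, [V n] is the binary logarithm of the number of windows of
    length at most [n] up to Myhill-Nerode equivalence in the sliding window
    model, so the theorem says that this number is bounded, polynomial (and at
    least [n + 1]), or exponential infinitely often.  The gap above the bounded
    case holds for every language.  For the gap above the polynomial case assume
    that [V] is sublinear; then no family of windows indexed by bit strings [s],
    of length linear in that of [s], consists of pairwise inequivalent windows.

    Windows are parsed into trees whose nodes carry labels from a finite set,
    such that two contexts leading from a label back to itself can be nested in
    any order.  If two such loops of the same size were distinguishable, nesting
    them along bit strings would give a forbidden family, so a loop is determined
    up to equivalence by its size and finite information.  Cutting a tree at the
    innermost occurrence of the label of its root and inducting on the set of
    labels gives polynomially many classes.

    This is applied to well-matched words (labelled by their action on states and
    by the equivalence of states induced by the rest of the window) and to words
    without pending returns (labelled by the equivalence of configurations they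
    induce).  In the latter, a loop is also seen through the stacks that it pushes
    when it is entered from states reached further left; these stacks are compared
    height by height, which makes their equivalence synchronous, so the
    lexicographically least stacks of all classes form a regular set, to which the
    same argument applies. *)

(** * Bit strings *)

(* Bijective base 2: a bit string of value [i] has length [trunc_log 2 i.+1]. *)
Fixpoint bits_val (b : seq bool) : nat :=
  if b is x :: b' then (bits_val b').*2 + x.+1 else 0.

Fixpoint bits_succ (b : seq bool) : seq bool :=
  match b with
  | [::] => [:: false]
  | false :: b' => true :: b'
  | true :: b' => false :: bits_succ b'
  end.

Definition bits_of (i : nat) : seq bool := iter i bits_succ [::].

Lemma bits_val_succ b : bits_val (bits_succ b) = (bits_val b).+1.
Proof. by elim: b => [|[] b IH] //=; rewrite ?IH; lia. Qed.

Lemma bits_ofK : cancel bits_of bits_val.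
Proof. by elim=> [|i IH] //=; rewrite bits_val_succ IH. Qed.

Lemma bits_val_size b : 2 ^ size b <= (bits_val b).+1 < 2 ^ (size b).+1.
Proof.
elim: b => [|x b /andP[IH1 IH2]] //=; rewrite !expnS in IH1 IH2 *.
by case: x; lia.
Qed.

Lemma bits_val_inj : injective bits_val.
Proof.
elim=> [|x b IH] [|y c] //=; try by lia.
by case: x; case: y => /= E; try (by lia); rewrite (IH c) //; lia.
Qed.

Lemma size_bits_of i : size (bits_of i) <= trunc_log 2 i.+1.
Proof.
have /andP[+ _] := bits_val_size (bits_of i).
by rewrite bits_ofK => ?; apply: trunc_log_max.
Qed.

(** * Window equivalence and the optimal space *)

Section Windows.
Variables (Sigma : finType) (L : seq Sigma -> bool).
Notation word := (seq Sigma).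
Notation step := (@wnd_step Sigma).

Definition weq (w w' : word) := forall u, L (foldl step w u) = L (foldl step w' u).

Lemma weq_sym w w' : weq w w' -> weq w' w.
Proof. by move=> H u. Qed.

Lemma weq_trans w2 w1 w3 : weq w1 w2 -> weq w2 w3 -> weq w1 w3.
Proof. by move=> H1 H2 u; rewrite H1. Qed.

Lemma weq_step w w' x : weq w w' -> weq (step w x) (step w' x).
Proof. by move=> H u; apply: (H (x :: u)). Qed.

Lemma foldl_wnd_push (w v : word) : foldl step v (map Some w) = v ++ w.
Proof. by elim: w v => [|a w IH] v /=; rewrite ?cats0 // IH cat_rcons. Qed.

Lemma foldl_wnd_pop i (w : word) : foldl step w (nseq i None) = drop i w.
Proof.
elim: i w => [|i IH] w /=; first by rewrite drop0.
by rewrite IH -drop1 drop_drop addn1.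
Qed.

Lemma weq_drop w w' i x : weq w w' -> L (drop i w ++ x) = L (drop i w' ++ x).
Proof.
by move=> /(_ (nseq i None ++ map Some x)); rewrite !foldl_cat !foldl_wnd_pop !foldl_wnd_push.
Qed.

(** Windows of equal length are popped in step, so after any updates what is left of them are
    suffixes from the same position, followed by the same new letters. *)
Lemma weq_suffixes w w' : size w = size w' ->
  (forall i x, L (drop i w ++ x) = L (drop i w' ++ x)) -> weq w w'.
Proof.
move=> sz_w H u; elim: u w w' sz_w H => [|[a|] u IH] w w' sz_w H /=.
- by have := H 0 [::]; rewrite !drop0 !cats0.
- apply: IH => [|i x]; first by rewrite !size_rcons sz_w.
  case: (leqP i (size w)) => hi.
    by rewrite !drop_rcons -?sz_w // !cat_rcons.
  by rewrite !drop_oversize ?size_rcons -?sz_w.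
- apply: IH => [|i x]; first by rewrite !size_behead sz_w.
  by rewrite -!drop1 !drop_drop.
Qed.

Variable V : nat -> nat.
Hypothesis VL : is_VL L V.

(** Pushing inequivalent windows leads to distinct states, and there are only [2 ^ (V n).+1 - 1] bit
    strings of length at most [V n]. *)
Lemma VL_lower n (T : finType) (g : T -> word) :
  (forall t, size (g t) <= n) -> (forall t t', weq (g t) (g t') -> t = t') ->
  #|T| < 2 ^ (V n).+1.
Proof.
move=> szg injg; have [[A [Acorr Asp]] _] := VL n.
pose st t := sw_run A (map Some (g t)).
have st_inj : injective st.
  move=> t t' Est; apply: injg => u.
  have /(congr1 (sw_out A)) : sw_run A (map Some (g t) ++ u) = sw_run A (map Some (g t') ++ u).
    by rewrite /sw_run !foldl_cat -!/(sw_run A _) -!/(st _) Est.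
  by rewrite !Acorr /wnd !foldl_cat !foldl_wnd_push.
have bound t : bits_val (st t) < (2 ^ (V n).+1).-1.
  have /andP[_ lt1] := bits_val_size (st t).
  suff : 2 ^ (size (st t)).+1 <= 2 ^ (V n).+1 by lia.
  rewrite leq_exp2l // ltnS; apply: Asp => k _.
  by rewrite -map_take /wnd foldl_wnd_push /= size_take_min (leq_trans (geq_minr _ _)).
have : #|T| <= #|'I_(2 ^ (V n).+1).-1|.
  apply: (@leq_card _ _ (fun t => Ordinal (bound t))) => t t' /(congr1 val) /= /bits_val_inj.
  exact: st_inj.
by rewrite card_ord; have := expn_gt0 2 (V n).+1; lia.
Qed.

(** An algorithm can store an encoded representative of the class of its window, with the shortest
    codes for the classes met at length at most [n]. *)
Lemma VL_upper n (U : finType) (f : word -> U) :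
  (forall w w', size w <= n -> size w' <= n -> f w = f w' -> weq w w') ->
  V n <= trunc_log 2 #|U|.
Proof.
move=> Hf.
have /choice[rep repP] : forall u : U, exists v, forall w, size w <= n -> f w = u -> weq w v.
  move=> u; have [[v [vn fv]]|no] := pselect (exists v, size v <= n /\ f v = u).
    by exists v => w wn fw; apply: Hf => //; rewrite fw.
  by exists [::] => w wn fw; case: no; exists w.
pose l := map rep (enum U); have szl : size l = #|U| by rewrite size_map -cardE.
have /choice[norm normP] : forall w, exists v, weq w v /\
    ((exists2 w0, size w0 <= n & weq w w0) -> v \in l).
  move=> w; have [[w0 w0n ww0]|no] := pselect (exists2 w0, size w0 <= n & weq w w0).
    exists (rep (f w0)); split=> [|_]; last by apply: map_f; rewrite mem_enum.
    by apply: weq_trans ww0 _; apply: repP.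
  by exists w; split=> // /no.
(* The algorithm has to be correct on longer windows too: codes below [#|U|] are kept for the list
   [l], all other words are shifted behind them. *)
pose enc v := bits_of (if v \in l then index v l else #|U| + pickle v).
pose dec b := let i := bits_val b in
  if i < #|U| then nth [::] l i else odflt [::] (unpickle (i - #|U|)).
have encK v : dec (enc v) = v.
  rewrite /dec /enc bits_ofK; case: (boolP (v \in l)) => vl.
    by rewrite -szl index_mem vl nth_index.
  by rewrite ltnNge leq_addr addKn pickleK.
pose A := @SwAlg Sigma (enc (norm [::])) (fun b x => enc (norm (step (dec b) x)))
                 (fun b => L (dec b)).
have inv u : exists v, [/\ sw_run A u = enc v, weq (wnd u) v & size (wnd u) <= n -> v \in l].
  elim/last_ind: u => [|u x [v [Ev wv _]]].
    exists (norm [::]); have [? Hl] := normP [::]; split=> // _.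
    by apply: Hl; exists [::].
  exists (norm (step v x)); have [H1 Hl] := normP (step v x).
  have E : wnd (rcons u x) = step (wnd u) x by rewrite /wnd foldl_rcons.
  rewrite E; split.
  - by rewrite /sw_run foldl_rcons -/(sw_run A u) Ev /= encK.
  - exact: weq_trans (weq_step x wv) H1.
  - by move=> sz; apply: Hl; exists (step (wnd u) x) => //; apply: weq_sym; apply: weq_step.
have [_ Vmin] := VL n; apply: (Vmin A) => u.
  by have [v [-> wv _]] := inv u; rewrite /= encK; have := wv [::].
move=> /(_ (size u) (leqnn _)); rewrite take_size => szu.
have [v [-> _ /(_ szu) vl]] := inv u; rewrite /enc vl.
apply: leq_trans (size_bits_of _) _; apply: leq_trunc_log.
by rewrite -szl index_mem.
Qed.

Definition wcode n (w : word) : {ffun 'I_n -> option Sigma} :=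
  [ffun i : 'I_n => nth None (map Some w) i].

Lemma wcode_inj n w w' : size w <= n -> size w' <= n -> wcode n w = wcode n w' -> w = w'.
Proof.
move=> szw szw' E.
have nthE i : nth None (map Some w) i = nth None (map Some w') i.
  case: (ltnP i n) => hi; last by rewrite !nth_default ?size_map //; lia.
  by have /ffunP/(_ (Ordinal hi)) := E; rewrite !ffunE.
suff : map Some w = map Some w' by apply: inj_map => ? ? [].
have nz (v : word) i : (nth None (map Some v) i == None) = (size v <= i).
  case: (leqP (size v) i) => hi; first by rewrite nth_default ?size_map.
  by case: v hi => // a v hi; rewrite (nth_map a).
apply: (@eq_from_nth _ None) => [|i _]; last exact: nthE.
rewrite !size_map; apply/eqP; rewrite eqn_leq -(nz w) nthE nz leqnn.
by rewrite -(nz w') -nthE nz leqnn.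
Qed.

Lemma VL_lin : bigO_lin V.
Proof.
(* There are at most [k ^ n <= 2 ^ (k * n)] codes of windows of length at most [n], where
   [k = #|Sigma|.+1]. *)
exists #|Sigma|.+1, 0 => n _.
apply: leq_trans (VL_upper (f := wcode n) _) _.
  by move=> w w' szw szw' /wcode_inj -> //.
rewrite card_ffun card_ord card_option.
rewrite -[leqRHS](trunc_expnK (p := 2)) //; apply: leq_trunc_log.
by rewrite expnM; case: n => [//|n]; rewrite leq_exp2r //; apply/ltnW/ltn_expl.
Qed.

(** Either every length [m] has a window inequivalent to all shorter ones, which makes [n.+1]
    classes up to length [n], or some [m] has none; then every window reduces to one shorter than
    [m] and [V] is bounded. *)
Lemma VL_log : ~ bigO1 V -> bigOmega_log V.
Proof.
move=> unb.
have /choice[w wP] : forall m, exists w, size w = m /\ forall w' : word, size w' < m -> ~ weq w w'.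
  move=> m; apply: contrapT => nofresh; apply: unb.
  have small w : exists2 v, size v < m & weq w v.
    elim/last_ind: w => [|w a [v vm wv]].
      case: (posnP m) => [m0|]; last by exists [::].
      by case: nofresh; exists [::]; rewrite m0.
    have wva := weq_step (Some a) wv; rewrite /= in wva.
    case: (ltnP (size v).+1 m) => szv.
      by exists (rcons v a); rewrite ?size_rcons.
    apply: contrapT => no; apply: nofresh; exists (rcons v a); split=> [|w' w'm vw'].
      by rewrite size_rcons; lia.
    by apply: no; exists w' => //; apply: weq_trans wva vw'.
  have /choice[r rP] : forall w, exists v, size v < m /\ weq w v.
    by move=> w; have [v] := small w; exists v.
  exists (trunc_log 2 #|{ffun 'I_m -> option Sigma}|), 0 => n _.
  apply: (VL_upper (f := fun w => wcode m (r w))) => w1 w2 _ _ E.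
  have [s1 e1] := rP w1; have [s2 e2] := rP w2.
  apply: weq_trans e1 _; apply: weq_sym; apply: weq_trans e2 _.
  by rewrite (wcode_inj _ _ E) // ltnW.
exists 1, 1 => n n0; rewrite mul1n.
have : #|'I_n.+1| < 2 ^ (V n).+1; last rewrite card_ord => lt.
  apply: (@VL_lower n _ (fun i : 'I_n.+1 => w i)) => [i|i j wij]; first by rewrite (wP i).1 -ltnS.
  apply/val_inj/eqP; rewrite eqn_leq.
  apply/andP; split; rewrite leqNgt; apply/negP => lt.
    by apply: (wP i).2 wij; rewrite (wP j).1.
  by apply: (wP j).2 (weq_sym wij); rewrite (wP i).1.
rewrite -ltnS -(ltn_exp2l _ _ (m := 2)) //.
by apply: leq_trans lt; rewrite ltnS; apply/leqW/trunc_logP.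
Qed.

Lemma littleo_collision : littleo_lin V -> forall a b (g : seq bool -> word),
  (forall s, size (g s) <= a * size s + b) ->
  exists s s', [/\ size s = size s', s <> s' & weq (g s) (g s')].
Proof.
move=> lo a b g szg; apply: contrapT => no.
(* At window length [a.+1 * m + b < a.+2 * m] the sublinear bound gives [V < m], too few states for
   [2 ^ m] windows; [m >= N] puts the length beyond the threshold. *)
have [N NP] := lo a.+2 isT; pose m := N + b + 1.
have : #|{: m.-tuple bool}| < 2 ^ (V (a.+1 * m + b)).+1.
  apply: (@VL_lower _ _ (fun t : m.-tuple bool => g t)) => [t|t t' tt'].
    by apply: leq_trans (szg t) _; rewrite size_tuple; lia.
  apply: contrapT => ne; apply: no; exists t, t'.
  by split=> //; rewrite ?size_tuple // => /val_inj.
rewrite card_tuple card_bool ltn_exp2l //.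
have := NP (a.+1 * m + b); rewrite /m; nia.
Qed.

End Windows.

(** * Polynomially many classes *)

(** The classifying map may depend on [n]. The base [n.+2] is at least 2, so that a larger exponent
    absorbs constant factors. *)
Definition pol (T : Type) (P : T -> Prop) (sz : T -> nat) (R : T -> T -> Prop) :=
  exists d, forall n, exists (U : finType) (f : T -> U), #|U| <= n.+2 ^ d /\
    forall x y, P x -> P y -> sz x <= n -> sz y <= n -> f x = f y -> R x y.

Section Pol.
Implicit Types T : Type.

Lemma pol_sub T (P P' : T -> Prop) sz (R R' : T -> T -> Prop) :
  (forall x, P' x -> P x) -> (forall x y, P' x -> P' y -> R x y -> R' x y) ->
  pol P sz R -> pol P' sz R'.
Proof.
move=> sP sR [d Hd]; exists d => n; have [U [f [cU Hf]]] := Hd n.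
by exists U, f; split=> // x y Px Py sx sy fxy; apply: (sR) => //; apply: Hf; auto.
Qed.

Lemma pol_fin (T : finType) P sz : @pol T P sz eq.
Proof.
exists #|T| => n; exists T, id; split=> //.
by apply: leq_trans (ltnW (ltn_expl _ (ltnSn 1))) _; case: #|T| => // k; rewrite leq_exp2r.
Qed.

Lemma pol_nat P : @pol nat P id eq.
Proof.
exists 1 => n; exists 'I_n.+1, inord; split=> [|x y _ _ sx sy /(congr1 val)].
  by rewrite card_ord expn1.
by rewrite /= !inordK.
Qed.

Lemma pol_prod T1 T2 P1 P2 sz1 sz2 R1 R2 :
  @pol T1 P1 sz1 R1 -> @pol T2 P2 sz2 R2 ->
  pol (fun p => P1 p.1 /\ P2 p.2) (fun p => maxn (sz1 p.1) (sz2 p.2))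
      (fun p q => R1 p.1 q.1 /\ R2 p.2 q.2).
Proof.
move=> [d1 H1] [d2 H2]; exists (d1 + d2) => n.
have [U1 [f1 [c1 {}H1]]] := H1 n; have [U2 [f2 [c2 {}H2]]] := H2 n.
exists (U1 * U2)%type, (fun p => (f1 p.1, f2 p.2)); split.
  by rewrite card_prod expnD leq_mul.
move=> [x1 x2] [y1 y2] /= [? ?] [? ?]; rewrite !geq_max => /andP[? ?] /andP[? ?].
by case=> e1 e2; split; [apply: H1 | apply: H2].
Qed.

(** [dec] is a relation because decompositions are not unique: one is chosen for each [x], with
    [None] outside [P]. *)
Lemma pol_pull T T' P sz R (P' : T' -> Prop) sz' R' (dec : T -> T' -> Prop) :
  pol P' sz' R' ->
  (forall x, P x -> exists y, [/\ P' y, sz' y <= sz x & dec x y]) ->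
  (forall x x' y y', P x -> P x' -> dec x y -> dec x' y' -> R' y y' -> R x x') ->
  @pol T P sz R.
Proof.
move=> [d Hd] Hdec HR; exists d.+1 => n; have [U [f [cU Hf]]] := Hd n.
have /choice[g gP] : forall x, exists o : option T', P x ->
    exists y, [/\ o = Some y, P' y, sz' y <= sz x & dec x y].
  move=> x; have [/Hdec[y [*]]|nPx] := pselect (P x); last by exists None.
  by exists (Some y) => _; exists y.
exists (option U), (fun x => omap f (g x)); split.
  by rewrite card_option expnS; have := expn_gt0 n.+2 d; nia.
move=> x x' Px Px' sx sx'.
have [y [-> Py sy dy]] := gP _ Px; have [y' [-> Py' sy' dy']] := gP _ Px' => -[E].
by apply: (HR _ _ _ _ Px Px' dy dy'); apply: Hf => //; lia.
Qed.

Definition optP T (P : T -> Prop) (o : option T) := if o is Some x then P x else True.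
Definition optR T (R : T -> T -> Prop) (o o' : option T) :=
  match o, o' with Some x, Some y => R x y | None, None => True | _, _ => False end.
Definition optsz T (sz : T -> nat) (o : option T) := if o is Some x then sz x else 0.

Lemma pol_opt T P sz R : @pol T P sz R -> pol (optP P) (optsz sz) (optR R).
Proof.
move=> [d Hd]; exists d.+1 => n; have [U [f [cU Hf]]] := Hd n.
exists (option U), (omap f); split.
  by rewrite card_option expnS; have := expn_gt0 n.+2 d; nia.
by move=> [x|] [y|] //= Px Py sx sy [E]; apply: Hf.
Qed.

Lemma pol_unif (I : finType) T (P : I -> T -> Prop) sz R :
  (forall i, pol (P i) sz (R i)) ->
  exists d, forall n, exists N (f : I -> T -> 'I_N), N <= n.+2 ^ d /\
    forall i x y, P i x -> P i y -> sz x <= n -> sz y <= n -> f i x = f i y -> R i x y.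
Proof.
have [[t0 _]|noT] := pselect (exists t : T, True); last first.
  move=> _; exists 0 => n; exists 1, (fun _ _ => ord0); split=> // i x.
  by case: noT; exists x.
move=> /choice[d Hd]; exists (\sum_i d i) => n.
have /choice[f fP] : forall i, exists f : T -> 'I_(n.+2 ^ \sum_i d i),
    forall x y, P i x -> P i y -> sz x <= n -> sz y <= n -> f x = f y -> R i x y.
  move=> i; have [U [f [cU Hf]]] := Hd i n.
  have le : #|U| <= n.+2 ^ \sum_i d i.
    by apply: leq_trans cU _; rewrite leq_exp2l // (bigD1 i) //= leq_addr.
  exists (fun x => widen_ord le (enum_rank (f x))) => x y Px Py sx sy.
  by move=> /(congr1 val) /= /val_inj/enum_rank_inj; apply: Hf.
by exists (n.+2 ^ \sum_i d i), f.
Qed.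

Lemma pol_fam (I : finType) T (P : I -> T -> Prop) sz R :
  (forall i, pol (P i) sz (R i)) ->
  pol (fun p => P p.1 p.2) (fun p => sz p.2) (fun p q => p.1 = q.1 /\ R p.1 p.2 q.2).
Proof.
move=> /pol_unif[d Hd]; exists (#|I| + d) => n; have [N [f [cN Hf]]] := Hd n.
exists (I * 'I_N)%type, (fun p => (p.1, f p.1 p.2)); split.
  rewrite card_prod card_ord expnD leq_mul //.
  by apply: leq_trans (ltnW (ltn_expl _ (ltnSn 1))) _; case: #|I| => // k; rewrite leq_exp2r.
by move=> [i x] [j y] /= Px Py sx sy [E]; rewrite -E in Py * => ?; split=> //; apply: Hf.
Qed.

Lemma pol_all (I : finType) T (P : T -> Prop) sz (R : I -> T -> T -> Prop) :
  (forall i, pol P sz (R i)) -> pol P sz (fun x y => forall i, R i x y).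
Proof.
move=> /pol_unif[d Hd]; exists (d * #|I|) => n; have [N [f [cN Hf]]] := Hd n.
exists {ffun I -> 'I_N}, (fun x => [ffun i => f i x]); split.
  by rewrite card_ffun card_ord expnM; case: #|I| => // k; rewrite leq_exp2r.
by move=> x y Px Py sx sy /ffunP E i; have := E i; rewrite !ffunE; apply: Hf.
Qed.

Lemma pol_half T P sz R : @pol T P sz R -> pol P (fun x => (sz x)./2) R.
Proof.
(* A size whose half is at most [n] is at most [n.*2.+1], and [2 * n + 3 <= n.+2 ^ 2]. *)
move=> [d Hd]; exists (2 * d) => n; have [U [f [cU Hf]]] := Hd n.*2.+1.
exists U, f; split; last by move=> x y Px Py sx sy; apply: Hf => //; lia.
apply: leq_trans cU _; rewrite expnM; case: d {Hd} => // d; rewrite leq_exp2r //.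
by rewrite expnS expn1; nia.
Qed.

End Pol.

(** * Trees with finitely many labels *)

Section Tree.
Variables (X D K : Type) (N : finType) (lab : X -> N).
Variables (sz : X -> nat) (R : X -> X -> Prop).
Variables (PD : D -> Prop) (szD : D -> nat) (RD : D -> D -> Prop).
Variables (PK : K -> Prop) (szK : K -> nat) (RK : K -> K -> Prop).
(* [node x d o1 o2]: the root of [x] carries the datum [d] and has at most the
   two subtrees [o1] and [o2]; [desc x x0 k]: [x] is [x0] inside the context [k]. *)
Variable node : X -> D -> option X -> option X -> Prop.
Variable desc : X -> X -> K -> Prop.

Inductive tree (S : {set N}) : X -> Prop :=
  Tree x d o1 o2 of node x d o1 o2 & lab x \in S &
    (forall y, o1 = Some y -> tree S y) & (forall y, o2 = Some y -> tree S y) : tree S x.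

Hypothesis polD : pol PD szD RD.
Hypothesis polK : pol PK szK RK.
Hypothesis node_size : forall x d o1 o2, node x d o1 o2 ->
  [/\ PD d, szD d <= sz x, optsz sz o1 <= sz x & optsz sz o2 <= sz x].
Hypothesis desc_size : forall x x0 k, desc x x0 k -> [/\ PK k, szK k <= sz x & sz x0 <= sz x].
Hypothesis desc_refl : forall x d o1 o2, node x d o1 o2 -> exists k, desc x x k.
Hypothesis desc_l : forall x d y o2 x0 k, node x d (Some y) o2 -> desc y x0 k ->
  exists k', desc x x0 k'.
Hypothesis desc_r : forall x d y o1 x0 k, node x d o1 (Some y) -> desc y x0 k ->
  exists k', desc x x0 k'.
Hypothesis node_R : forall x d o1 o2 x' d' o1' o2',
  node x d o1 o2 -> node x' d' o1' o2' -> lab x = lab x' ->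
  RD d d' -> optR R o1 o1' -> optR R o2 o2' -> R x x'.
Hypothesis loop_R : forall x x0 k x' x0' k', desc x x0 k -> desc x' x0' k' ->
  lab x0 = lab x -> lab x0' = lab x -> lab x' = lab x ->
  RK k k' -> R x0 x0' -> R x x'.

Lemma tree_lab S x : tree S x -> lab x \in S.
Proof. by case. Qed.

Definition is_innermost S A x0 d o1 o2 :=
  [/\ node x0 d o1 o2, lab x0 = A, optP (tree (S :\ A)) o1 & optP (tree (S :\ A)) o2].

(** In the induction an occurrence of [A] inside a subtree takes precedence over one at the root, so
    that [A] is absent below the chosen one. *)
Lemma tree_innermost S A x : tree S x ->
  tree (S :\ A) x \/ exists x0 k d o1 o2, desc x x0 k /\ is_innermost S A x0 d o1 o2.
Proof.
elim=> {}x d o1 o2 nx lx _ IH1 _ IH2.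
have free1 : optP (tree (S :\ A)) o1 \/
    exists x0 k d o1 o2, desc x x0 k /\ is_innermost S A x0 d o1 o2.
  case: o1 nx IH1 => [y|] nx IH1 /=; last by left.
  have [|[x0 [k [d' [o1' [o2' [dy ?]]]]]]] := IH1 y erefl; first by left.
  by have [k' ?] := desc_l nx dy; right; exists x0, k', d', o1', o2'.
have free2 : optP (tree (S :\ A)) o2 \/
    exists x0 k d o1 o2, desc x x0 k /\ is_innermost S A x0 d o1 o2.
  case: o2 nx IH2 {free1} => [y|] nx IH2 /=; last by left.
  have [|[x0 [k [d' [o1' [o2' [dy ?]]]]]]] := IH2 y erefl; first by left.
  by have [k' ?] := desc_r nx dy; right; exists x0, k', d', o1', o2'.
case: free1 => [f1|]; last by right.
case: free2 => [f2|]; last by right.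
have [lA|lA] := eqVneq (lab x) A.
  by right; have [k ?] := desc_refl nx; exists x, k, d, o1, o2.
left; apply: (@Tree _ x d o1 o2) => //; first by rewrite !inE lA.
  by case: o1 f1 {nx IH1} => // y f1 _ [<-].
by case: o2 f2 {nx IH2} => // y f2 _ [<-].
Qed.

(* Induction on the set of allowed labels: a tree is its innermost node with the
   label of the root, which is put into a loop context; below this node that
   label no longer occurs. *)
Theorem pol_tree S : pol (tree S) sz R.
Proof.
elim: {S}_.+1 {-2}S (ltnSn #|S|) => // m IH S cS.
pose PA A x := A \in S /\ tree (S :\ A) x.
have polA A : pol (PA A) sz R.
  have [AS|AS] := boolP (A \in S); last first.
    exists 0 => n; exists unit, (fun=> tt); split; first by rewrite card_unit.
    by move=> x y []; rewrite (negbTE AS).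
  by apply: pol_sub (IH (S :\ A) _) => [x []|//|]; last by rewrite (cardsD1 A) AS in cS.
have poly := pol_prod (pol_fam (fun A =>
  pol_prod (pol_opt (polA A)) (pol_opt (polA A)))) (pol_prod polD polK).
pose dec x (y : N * (option X * option X) * (D * K)) :=
  exists x0, [/\ desc x x0 y.2.2, lab x = y.1.1 &
                 is_innermost S y.1.1 x0 y.2.1 y.1.2.1 y.1.2.2].
apply: (pol_pull (dec := dec) poly).
- move=> x Tx; have lS := tree_lab Tx.
  have [|[x0 [k [d [o1 [o2 [dx [nx lx t1 t2]]]]]]]] := tree_innermost (lab x) Tx.
    by move=> /tree_lab; rewrite !inE eqxx.
  have [PKk sk s0] := desc_size dx; have [PDd sd s1 s2] := node_size nx.
  exists ((lab x, (o1, o2)), (d, k)); split; last by exists x0.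
  + split; split=> //=; rewrite /PA.
      by case: (o1) t1 => //=.
    by case: (o2) t2 => //=.
  + by rewrite /= !geq_max; lia.
- move=> x x' [[A [o1 o2]] [d k]] [[A' [o1' o2']] [d' k']] _ _ /= [x0 /= [dx lx]].
  move=> [nx lx0 _ _] [x0' /= [dx' lx' [nx' lx0' _ _]]] [[/= AA' [R1 R2]] [RDd RKk]].
  rewrite -{}AA' in lx' lx0'.
  apply: (loop_R dx dx') => //; rewrite ?lx ?lx' ?lx0 ?lx0' //.
  by apply: node_R nx nx' _ RDd R1 R2; rewrite lx0.
Qed.

End Tree.

(** * Runs of a visibly pushdown automaton *)

Section Vpa.
Variables (Sigma Q Gam : finType) (kind : Sigma -> letter_kind) (bot : Gam) (q0 : Q).
Variables (dc : Q -> Sigma -> Gam * Q) (dr : Q -> Sigma -> Gam -> Q) (di : Q -> Sigma -> Q).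
Variable F : pred Q.
Notation word := (seq Sigma).
Notation cfg := (seq Gam * Q)%type.
Notation step := (vpa_step kind bot dc dr di).

Definition run (c : cfg) (w : word) : cfg := foldl step c w.
Definition st (w : word) : cfg := run ([::], q0) w.
Definition act (w : word) : {ffun Q -> Q} := [ffun p => (run ([::], p) w).2].

Lemma run_cat c x y : run c (x ++ y) = run (run c x) y.
Proof. exact: foldl_cat. Qed.

Lemma st_cat x y : st (x ++ y) = run (st x) y.
Proof. exact: run_cat. Qed.

(* [None] means that a return letter is read at height [0]. *)
Fixpoint dep (h : nat) (w : word) : option nat :=
  if w is a :: w' then
    match kind a, h with
    | Call, _ => dep h.+1 w'
    | Int, _ => dep h w'
    | Ret, h'.+1 => dep h' w'
    | Ret, 0 => None
    end
  else Some h.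

Lemma dep_cat h x y : dep h (x ++ y) = if dep h x is Some k then dep k y else None.
Proof. by elim: x h => [|a x IH] h //=; case: (kind a) => //; case: h. Qed.

Lemma dep_add h w k j : dep h w = Some k -> dep (h + j) w = Some (k + j).
Proof.
elim: w h => [|a w IH] h /=; first by case=> ->.
by case: (kind a) => [/IH //||/IH //]; case: h => // h /IH.
Qed.

Lemma dep_le h w k : dep h w = Some k -> k <= h + size w.
Proof.
elim: w h => [|a w IH] h /=; first by case=> ->; rewrite addn0.
by case: (kind a) => [/IH||/IH]; [lia | case: h => // h /IH; lia | lia].
Qed.

Lemma dep_none h x : dep h x = None ->
  exists v r x', [/\ x = v ++ r :: x', dep h v = Some 0 & kind r = Ret].
Proof.
elim: x h => [|a x IH] h //=; case ka: (kind a).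
- by case/IH=> v [r [x' [-> dv kr]]]; exists (a :: v), r, x'; rewrite /= ka.
- case: h => [_|h /IH[v [r [x' [-> dv kr]]]]]; first by exists [::], a, x.
  by exists (a :: v), r, x'; rewrite /= ka.
- by case/IH=> v [r [x' [-> dv kr]]]; exists (a :: v), r, x'; rewrite /= ka.
Qed.

Lemma run_frame s1 s2 p w k : dep (size s1) w = Some k ->
  run (s1 ++ s2, p) w = ((run (s1, p) w).1 ++ s2, (run (s1, p) w).2) /\
  size (run (s1, p) w).1 = k.
Proof.
elim: w s1 p => [|a w IH] s1 p /=; first by case=> ->.
case: (kind a) => [||/IH //].
  by case: (dc p a) => g q; apply: (IH (g :: s1)).
by case: s1 => [|g s1] //= /IH.
Qed.

Lemma run_size_le h s p y k : dep h y = Some k -> size s <= h -> size (run (s, p) y).1 <= k.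
Proof.
elim: y h s p => [|a y IH] h s p /=; first by case=> ->.
case: (kind a) => [||/IH H] //; last exact: H.
  by case: (dc p a) => g q /IH H sh; apply: H.
by case: h => // h; case: s => [|g s] /IH H sh; apply: H.
Qed.

(* Well-matched words, words without pending returns, words without pending calls. *)
Definition wn (z : word) := dep 0 z = Some 0.
Definition asc (Y : word) : Prop := dep 0 Y.
Definition desc (y : word) := exists k, dep k y = Some 0.

Lemma ascP Y : asc Y -> {k | dep 0 Y = Some k}.
Proof. by rewrite /asc; case: dep => // k; exists k. Qed.

Lemma wn_run s p z : wn z -> run (s, p) z = (s, act z p).
Proof.
move=> wz; have [E /size0nil s0] := @run_frame [::] s p z 0 wz.
by rewrite E s0 ffunE.
Qed.

Lemma desc_run p y : desc y -> run ([::], p) y = ([::], act y p).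
Proof.
case=> k /(@run_size_le _ [::] p)/(_ isT); rewrite leqn0 => /eqP/size0nil.
by rewrite ffunE; case: run => s q /= ->.
Qed.

Lemma desc_drop i y : desc y -> desc (drop i y).
Proof.
case=> k; rewrite -{1}(cat_take_drop i y) dep_cat.
by case E: (dep k _) => [j|] // ?; exists j.
Qed.

Lemma wn_desc z : wn z -> desc z. Proof. by exists 0. Qed.

Lemma desc_ret r y : kind r = Ret -> desc y -> desc (r :: y).
Proof. by move=> kr [k Hk]; exists k.+1; rewrite /= kr. Qed.

Lemma act_cat x y p : desc x -> act (x ++ y) p = act y (act x p).
Proof. by move=> dx; rewrite [RHS]ffunE -(desc_run p dx) -run_cat ffunE. Qed.

Lemma act_ctx x z z' y : wn z -> wn z' -> act z = act z' -> act (x ++ z ++ y) = act (x ++ z' ++ y).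
Proof.
move=> wz wz' E; apply/ffunP=> p; rewrite !ffunE !run_cat.
by case: (run ([::], p) x) => s q; rewrite (wn_run _ _ wz) (wn_run _ _ wz') E.
Qed.

Lemma wn_cat x y : wn x -> wn y -> wn (x ++ y).
Proof. by rewrite /wn dep_cat => ->. Qed.

Lemma wn_asc z : wn z -> asc z.
Proof. by rewrite /asc => ->. Qed.

Lemma dep1_cat c z1 r z2 : kind c = Call -> kind r = Ret -> wn z1 ->
  dep 0 (c :: z1 ++ r :: z2) = dep 0 z2.
Proof.
move=> kc kr w1; rewrite /= kc dep_cat.
by have := dep_add 1 w1; rewrite add0n => -> /=; rewrite kr.
Qed.

Lemma asc_cases Y : asc Y ->
  [\/ Y = [::],
      exists a Y1, [/\ Y = a :: Y1, kind a = Int & dep 0 Y = dep 0 Y1],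
      exists a Y1, [/\ Y = a :: Y1, kind a = Call, asc Y1 & dep 0 Y = omap S (dep 0 Y1)] |
      exists c z r Y1, [/\ Y = c :: z ++ r :: Y1, kind c = Call, kind r = Ret, wn z &
                           dep 0 Y = dep 0 Y1]].
Proof.
rewrite /asc; case: Y => [|a Y] /=; first by constructor 1.
case ka: (kind a) => // aY; last by constructor 2; exists a, Y.
case E: (dep 0 Y) => [k|].
  constructor 3; exists a, Y; split=> //; first by rewrite /asc E.
  by have := dep_add 1 E; rewrite add0n addn1 E => ->.
(* The first pending return of the rest matches the call [a]. *)
have [z [r [Y1 [EY wz kr]]]] := dep_none E.
constructor 4; exists a, z, r, Y1; split=> //; first by rewrite EY.
by have := dep1_cat Y1 ka kr wz; rewrite /= ka -EY.
Qed.

(** * Equivalence of configurations *)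

Definition ceq (c c' : cfg) := forall x, F (run c x).2 = F (run c' x).2.

Lemma ceq_refl c : ceq c c. Proof. by []. Qed.
Lemma ceq_sym c c' : ceq c c' -> ceq c' c. Proof. by move=> H x. Qed.
Lemma ceq_trans c2 c1 c3 : ceq c1 c2 -> ceq c2 c3 -> ceq c1 c3.
Proof. by move=> H1 H2 x; rewrite H1. Qed.
Lemma ceq_run c c' y : ceq c c' -> ceq (run c y) (run c' y).
Proof. by move=> H x; rewrite -!run_cat. Qed.

Definition base (b b' : seq Gam) : {set Q * Q} :=
  [set qq | `[< ceq (b, qq.1) (b', qq.2) >]].

Lemma baseP b b' q q' : reflect (ceq (b, q) (b', q')) ((q, q') \in base b b').
Proof. by rewrite inE; apply: asboolP. Qed.

(* Whether two configurations with equally many symbols above their bases are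
   equivalent depends on the bases only through the finite set [base b b']:
   a distinguishing word either stays above the bases or reaches them in step. *)
Lemma ceq_base s s' r r' b b' b2 b2' : size s = size s' -> base b b' = base b2 b2' ->
  ceq (s ++ b, r) (s' ++ b', r') -> ceq (s ++ b2, r) (s' ++ b2', r').
Proof.
move=> sz B H x; case E: (dep (size s) x) => [k|].
  have E' := E; rewrite sz in E'; have := H x.
  by rewrite !(run_frame _ _ E).1 !(run_frame _ _ E').1.
have [v [a [x' [-> Ev ka]]]] := dep_none E.
have Ev' := Ev; rewrite sz in Ev'.
have := ceq_run v H; rewrite !run_cat.
have [-> /size0nil ->] := run_frame b r Ev; have [-> /size0nil ->] := run_frame b' r' Ev'.
have [-> /size0nil ->] := run_frame b2 r Ev; have [-> /size0nil ->] := run_frame b2' r' Ev'.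
by move=> /baseP; rewrite B => /baseP.
Qed.

(** Words without pending calls see the rest [Y] of the window only through this set. *)
Definition ker (Y : word) : {set Q * Q} :=
  [set qq | `[< ceq (run ([::], qq.1) Y) (run ([::], qq.2) Y) >]].

Lemma kerP Y q q' : reflect (ceq (run ([::], q) Y) (run ([::], q') Y)) ((q, q') \in ker Y).
Proof. by rewrite inE; apply: asboolP. Qed.

Definition pull (y : word) (e : {set Q * Q}) : {set Q * Q} :=
  [set qq | (act y qq.1, act y qq.2) \in e].

Lemma in_pull y e q q' : ((q, q') \in pull y e) = ((act y q, act y q') \in e).
Proof. by rewrite inE. Qed.

Lemma ker_cat y Y : desc y -> ker (y ++ Y) = pull y (ker Y).
Proof.
move=> dy; apply/setP=> -[q q']; rewrite in_pull.
by apply/kerP/kerP; rewrite !run_cat !(desc_run _ dy).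
Qed.

Lemma pull_cat x y e : desc x -> pull (x ++ y) e = pull x (pull y e).
Proof. by move=> dx; apply/setP=> -[q q']; rewrite !in_pull !act_cat. Qed.

(* Holds when the window equivalence classes grow subexponentially. *)
Hypothesis collision : forall a b (g : seq bool -> word),
  (forall s, size (g s) <= a * size s + b) ->
  exists s s', [/\ size s = size s', s <> s' &
                   forall i, ceq (st (drop i (g s))) (st (drop i (g s')))].
(** * Well-matched words *)

(** The two halves of a context that keeps well-matched words well-matched. *)
Definition cx (x y : word) := asc x /\ wn (x ++ y).

Lemma cx_split x y : cx x y -> exists2 k, dep 0 x = Some k & dep k y = Some 0.
Proof. by case=> /ascP[k Hk]; rewrite /wn dep_cat Hk; exists k. Qed.

Lemma cx_desc x y : cx x y -> desc y.
Proof. by case/cx_split=> k _ ?; exists k. Qed.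

Lemma cx_wn x z y : cx x y -> wn z -> wn (x ++ z ++ y).
Proof.
case/cx_split=> k Hx Hy wz; rewrite /wn dep_cat Hx dep_cat.
by have := dep_add k wz; rewrite add0n => ->.
Qed.

Lemma cx_int a x y : kind a = Int -> cx x y -> cx (a :: x) y.
Proof. by move=> ka; rewrite /cx /asc /wn /= ka. Qed.

Lemma cx_l c r z2 x y : kind c = Call -> kind r = Ret -> wn z2 ->
  cx x y -> cx (c :: x) (y ++ r :: z2).
Proof.
move=> kc kr wz /cx_split[k Hx Hy]; rewrite /cx /asc /wn /= kc dep_cat.
have := dep_add 1 Hx; rewrite add0n => ->; split=> //.
by rewrite dep_cat (dep_add 1 Hy) /= kr.
Qed.

Lemma cx_r c r z1 x y : kind c = Call -> kind r = Ret -> wn z1 ->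
  cx x y -> cx (c :: z1 ++ r :: x) y.
Proof.
move=> kc kr wz; rewrite /cx /asc /wn (dep1_cat _ kc kr wz) => -[Hx Hxy]; split=> //.
by rewrite cat_cons -catA cat_cons (dep1_cat _ kc kr wz).
Qed.

Lemma wn_cases z : wn z ->
  [\/ z = [::],
      exists a z1, [/\ z = a :: z1, kind a = Int & wn z1] |
      exists c z1 r z2, [/\ z = c :: z1 ++ r :: z2, kind c = Call, kind r = Ret, wn z1 & wn z2]].
Proof.
move=> wz; have [->|[a [z1 [Ez ka E]]]|[a [z1 [Ez ka _]]]|[c [z1 [r [z2 [Ez kc kr w1 E]]]]]] :=
  asc_cases (wn_asc wz).
- by constructor 1.
- by constructor 2; exists a, z1; split=> //; rewrite /wn -E.
- by rewrite wz; case: dep.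
- by constructor 3; exists c, z1, r, z2; split=> //; rewrite /wn -E.
Qed.

Lemma drop_catl (T : Type) i (x w : seq T) : i <= size x -> drop i (x ++ w) = drop i x ++ w.
Proof.
rewrite leq_eqVlt => /predU1P[->|lt]; last by rewrite drop_cat lt.
by rewrite drop_size_cat // drop_size.
Qed.

Lemma drop_catr (T : Type) i (x w : seq T) : drop (size x + i) (x ++ w) = drop i w.
Proof. by rewrite addnC -drop_drop drop_size_cat. Qed.

Lemma st_desc w Y : desc w -> st (w ++ Y) = run ([::], act w q0) Y.
Proof. by move=> dw; rewrite st_cat /st desc_run. Qed.

Lemma ker_st w w' Y : desc w -> desc w' ->
  ceq (st (w ++ Y)) (st (w' ++ Y)) -> (act w q0, act w' q0) \in ker Y.
Proof. by move=> dw dw'; rewrite !st_desc // => /kerP. Qed.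

Lemma ker_sym Y q q' : (q, q') \in ker Y -> (q', q) \in ker Y.
Proof. by move/kerP => H; apply/kerP/ceq_sym. Qed.

(* Nesting two different loop contexts in all possible ways gives exponentially
   many windows, told apart by the outermost position where they differ. *)
Lemma nest_collision (x y : bool -> word) z Y (e := ker Y) :
  (forall b, cx (x b) (y b)) -> size (x true) = size (x false) ->
  size (y true) = size (y false) -> wn z ->
  (forall b, act (x b ++ z ++ y b) = act z) -> (forall b, pull (y b) e = e) ->
  (forall i, i <= size (x true) ->
     (act (drop i (x true) ++ z ++ y true) q0, act (drop i (x false) ++ z ++ y false) q0) \in e) /\
  (forall i, (act (drop i (y true)) q0, act (drop i (y false)) q0) \in e).
Proof.
move=> cxy szx szy wz actz pulle.
pose nest := foldr (fun b w => x b ++ w ++ y b) z.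
have nestE b s : nest (b :: s) = x b ++ nest s ++ y b by [].
have wn_nest s : wn (nest s) by elim: s => //= b s IH; apply: cx_wn.
have act_nest s : act (nest s) = act z.
  elim: s => //= b s IH; rewrite -[RHS](actz b).
  by apply: act_ctx.
have szxb b : size (x b) = size (x true) by case: b.
have szyb b : size (y b) = size (y true) by case: b.
have size_nest s : size (nest s) = size s * (size (x true) + size (y true)) + size z.
  by elim: s => //= b s IH; rewrite !size_cat IH szxb szyb; lia.
have [|s [s' [szs ss' Hs]]] := collision (a := size (x true) + size (y true))
    (b := size z + size Y) (g := fun s => nest s ++ Y).
  by move=> s; rewrite size_cat size_nest; lia.
have {s s' szs ss' Hs} [b [b' [bb' Hx Hy]]] : exists b b', [/\ b != b',
    forall i, i <= size (x b) ->
      (act (drop i (x b) ++ z ++ y b) q0, act (drop i (x b') ++ z ++ y b') q0) \in e &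
    forall i, (act (drop i (y b)) q0, act (drop i (y b')) q0) \in e].
  (* [Y] is generalized to any [Y'] with the same kernel, so that the right halves of common outer
     layers can be moved into it. *)
  have [Y' EY kY'] : exists2 Y', Y' = Y & ker Y' = e by exists Y.
  rewrite -{}EY in Hs; elim: s s' szs ss' Y' kY' Hs => [|b s IH] [|b' s'] // [szs] ss' Y' kY' Hs.
  have [bb'|bb'] := eqVneq b b'.
    rewrite -bb' in Hs ss'; apply: (IH s' szs _ (y b ++ Y')).
    - by move=> E; apply: ss'; rewrite E.
    - by rewrite ker_cat ?kY' //; apply: cx_desc (cxy b).
    - by move=> i; have := Hs (size (x b) + i); rewrite !nestE -!catA !drop_catr.
  exists b, b'; split=> // i.
    move=> hi; have hx c : i <= size (x c) by rewrite (szxb c) -(szxb b).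
    have := Hs i; rewrite !nestE -!catA !drop_catl //.
    rewrite !(catA _ (y _)) !(catA _ (_ ++ y _)) => /ker_st; rewrite kY'.
    have dd c t : desc (drop i (x c) ++ nest t ++ y c).
      by rewrite -(drop_catl _ (hx c)); apply/desc_drop/wn_desc/cx_wn.
    (* The inner nest has the action of [z], whatever the remaining bits are. *)
    have aa c t : act (drop i (x c) ++ nest t ++ y c) = act (drop i (x c) ++ z ++ y c).
      exact: act_ctx.
    by move/(_ (dd _ _) (dd _ _)); rewrite !aa.
  have szn : size (x b ++ nest s) = size (x b' ++ nest s').
    by rewrite !size_cat !size_nest szs !szxb.
  have [hi|hi] := leqP i (size (y b)); last first.
    rewrite !drop_oversize ?szyb -?(szyb b) ?(ltnW hi) // -kY'.
    by apply/kerP; apply: ceq_refl.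
  have := Hs (size (x b ++ nest s) + i); rewrite !nestE -!catA !(catA (x _)).
  rewrite {2}szn !drop_catr !drop_catl ?szyb -?(szyb b) // => /ker_st; rewrite kY'.
  by apply; apply/desc_drop/cx_desc.
rewrite szxb in Hx; case: b b' bb' Hx Hy => -[] // _ Hx Hy.
by split=> i *; apply: ker_sym; auto.
Qed.

(** All suffixes are compared because pops cut the window from the left; [e] is the kernel of what
    follows the word. *)
Definition Rw (e : {set Q * Q}) (z z' : word) :=
  [/\ act z = act z', size z = size z' &
      forall i, (act (drop i z) q0, act (drop i z') q0) \in e].

(** Suffixes starting inside [x] or [y] are handled by [nest_collision], those starting inside [z]
    by the relation of [z] and [z'], since [pull y e = e]. *)
Lemma Rw_loop Y x y x' y' z z' (e := ker Y) :
  cx x y -> cx x' y' -> wn z -> wn z' -> size x = size x' -> size y = size y' ->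
  act (x ++ z ++ y) = act z -> act (x' ++ z' ++ y') = act z' ->
  pull y e = e -> pull y' e = e -> act y = act y' -> Rw e z z' ->
  Rw e (x ++ z ++ y) (x' ++ z' ++ y').
Proof.
move=> cxy cxy' wz wz' szx szy az az' py py' ay [azz szz zz].
have az'' : act (x' ++ z ++ y') = act z by rewrite (act_ctx _ _ wz wz') // az'.
have [|b|b|Hx Hy] := @nest_collision (fun b => if b then x else x')
  (fun b => if b then y else y') z Y _ szx szy wz; first by case.
- by case: b.
- by case: b.
split; first by rewrite az az'.
  by rewrite !size_cat szx szy szz.
move=> i; have [hi|hi] := leqP i (size x).
  rewrite !drop_catl -?szx //; have := Hx i hi => /=.
  by rewrite -(act_ctx (drop i x') y' wz wz').
have [j ->] : exists j, i = size x + j by exists (i - size x); rewrite subnKC // ltnW.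
rewrite drop_catr szx drop_catr.
have [hj|hj] := leqP j (size z); last first.
  have [k ->] : exists k, j = size z + k by exists (j - size z); rewrite subnKC // ltnW.
  by rewrite drop_catr szz drop_catr; apply: Hy.
rewrite !drop_catl -?szz // !act_cat; try by apply/desc_drop/wn_desc.
by rewrite -ay -in_pull py.
Qed.

(** A tree is a well-matched word paired with the kernel of the text after it; for the block inside
    a matched pair this text starts with the return letter. *)
Definition nodeW (p : word * {set Q * Q}) (d : option Sigma * option Sigma)
    (o1 o2 : option (word * {set Q * Q})) :=
  [/\ wn p.1, exists Y, p.2 = ker Y &
   [\/ [/\ p.1 = [::], d = (None, None), o1 = None & o2 = None],
       exists a z, [/\ p.1 = a :: z, kind a = Int /\ wn z, d = (Some a, None),
                       o1 = Some (z, p.2) & o2 = None] |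
       exists c z1 r z2, [/\ p.1 = c :: z1 ++ r :: z2,
                       [/\ kind c = Call, kind r = Ret, wn z1 & wn z2], d = (Some c, Some r),
                       o1 = Some (z1, pull (r :: z2) p.2) & o2 = Some (z2, p.2)]]].

Definition descW (p p0 : word * {set Q * Q}) (k : nat * nat * {ffun Q -> Q}) :=
  exists x y, [/\ p.1 = x ++ p0.1 ++ y, cx x y, wn p0.1, exists Y, p.2 = ker Y &
                  p0.2 = pull y p.2 /\ k = (size x, size y, act y)].

Lemma tree_wn z Y : wn z -> tree (fun p => (act p.1, p.2)) nodeW setT (z, ker Y).
Proof.
move: {2}(size z) (leqnn (size z)) => n; elim: n z Y => [|n IH] z Y.
  rewrite leqn0 => /eqP/size0nil -> wz.
  by apply: (@Tree _ _ _ _ _ _ _ (None, None) None None) => //; split=> //; [exists Y | constructor 1].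
move=> szn wz; case: (wn_cases wz) => [Ez|[a [z1 [Ez ka w1]]]|[c [z1 [r [z2 [Ez kc kr w1 w2]]]]]].
- apply: (@Tree _ _ _ _ _ _ _ (None, None) None None) => //.
  by split=> //; [exists Y | constructor 1].
- apply: (@Tree _ _ _ _ _ _ _ (Some a, None) (Some (z1, ker Y)) None) => //.
    by split=> //; [exists Y | constructor 2; exists a, z1].
  by move=> _ [<-]; apply: IH => //; rewrite Ez in szn.
- have dr2 : desc (r :: z2) by apply/desc_ret/wn_desc.
  apply: (@Tree _ _ _ _ _ _ _ (Some c, Some r)
            (Some (z1, pull (r :: z2) (ker Y))) (Some (z2, ker Y))) => //.
  + by split=> //; [exists Y | constructor 3; exists c, z1, r, z2].
  + by move=> _ [<-]; rewrite -ker_cat //; apply: IH => //; rewrite Ez /= size_cat /= in szn; lia.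
  + by move=> _ [<-]; apply: IH => //; rewrite Ez /= size_cat /= in szn; lia.
Qed.

Lemma pol_wn Y : pol wn size (Rw (ker Y)).
Proof.
pose RX (p p' : word * {set Q * Q}) := p.2 = p'.2 /\ Rw p.2 p.1 p'.1.
have polD : pol (fun=> True) (fun=> 0) (@eq (option Sigma * option Sigma)) by apply: pol_fin.
have polK := pol_prod (pol_prod (pol_nat (fun=> True)) (pol_nat (fun=> True)))
               (@pol_fin {ffun Q -> Q} (fun=> True) (fun=> 0)).
suff polX : pol (tree (fun p => (act p.1, p.2)) nodeW setT) (fun p => size p.1) RX.
  apply: (pol_pull (dec := fun z p => p = (z, ker Y)) polX) => [z wz|].
    by exists (z, ker Y); split=> //; apply: tree_wn.
  by move=> z z' _ _ _ _ -> -> [].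
apply: (pol_tree (desc := descW) polD polK) => //.
- move=> [z e] d o1 o2 [_ _] /= [[-> _ -> ->]|[a [z1 [-> _ _ -> ->]]]|] //=.
  by move=> [c [z1 [r [z2 [-> _ _ -> ->]]]]]; split=> //=; rewrite size_cat /=; lia.
- move=> [z e] [z0 e0] k [x [y [/= -> _ _ _ [_ ->]]]]; split=> //=; rewrite !size_cat; lia.
- move=> [z e] d o1 o2 [wz [Y' eY] _]; exists (0, 0, act [::]), [::], [::].
  split=> //=; first by rewrite cats0.
    by exists Y'.
  split=> //; apply/setP=> -[q q']; rewrite in_pull.
  by rewrite !ffunE.
- move=> [z e] d [z1 e1] o2 [z0 e0] k [wz [Y' /= eY]] H [x [y [/= E1 cxy w0 _ [e0E kE]]]].
  case: H => [[]|[a [z1' [Ez [ka _] _ [? ?] _]]]|[c [z1' [r [z2 [Ez [kc kr _ w2] _ [? ?] _]]]]]] //; subst.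
    exists (size (a :: x), size y, act y), (a :: x), y; split=> //=; first exact: cx_int.
    by exists Y'.
  exists (size (c :: x), size (y ++ r :: z2), act (y ++ r :: z2)), (c :: x), (y ++ r :: z2).
  split=> //=; first by rewrite -!catA.
  + exact: cx_l.
  + by exists Y'.
  + by rewrite pull_cat //; apply: cx_desc cxy.
- move=> [z e] d [z1 e1] o2 [z0 e0] k [wz [Y' /= eY]] H [x [y [/= E1 cxy w0 _ [e0E kE]]]].
  case: H => [[]|[a [z1' []]]|[c [z1' [r [z2 [Ez [kc kr w1 w2] _ _ [? ?]]]]]]] //; subst.
  exists (size (c :: z1' ++ r :: x), size y, act y), (c :: z1' ++ r :: x), y.
  split=> //=; first by rewrite -!catA.
  + exact: cx_r.
  + by exists Y'.
- move=> [z e] d o1 o2 [z' e'] d' o1' o2' [wz [Y' /= eY] H] [wz' _ /= H'] [/= ae ee] dd'.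
  subst d' e' e.
  have erf q : (q, q) \in ker Y' by apply/kerP; apply: ceq_refl.
  case: H H' ae => [[-> -> -> ->]|[a [z1 [-> [ka w1] -> -> ->]]]|[c [z1 [r [z2 [-> [kc kr w1 w2] -> -> ->]]]]]].
  + by move=> [[-> _ -> ->]|[? [? []]]|[? [? [? [? []]]]]] //.
  + move=> [[]|[a' [z1' [-> _ [<-] -> ->]]]|[? [? [? [? []]]]]] //= ae [_ [_ /= sz1 R1]] _.
    split=> //; split=> /=; [exact: ae | by rewrite sz1 |].
    by case=> [|i]; [rewrite !drop0 ae | apply: R1].
  + move=> [[]|[? [? []]]|[c' [z1' [r' [z2' [-> [_ _ w1' w2'] [<- <-] -> ->]]]]]] //.
    move=> ae [/= E1 [/= a1 sz1 R1]] [_ [/= a2 sz2 R2]]; split=> //; split=> //=.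
      by rewrite !size_cat /= sz1 sz2.
    have dr2 z3 : wn z3 -> desc (r :: z3) by move=> w3; apply/desc_ret/wn_desc.
    case=> [|i] /=; first by rewrite ae.
    have [hi|hi] := leqP i (size z1).
      rewrite !drop_catl -?sz1 // !act_cat; try by apply/desc_drop/wn_desc.
      suff -> : act (r :: z2') = act (r :: z2) by rewrite -in_pull.
      by apply/ffunP=> p; rewrite !ffunE /= kr; have /ffunP/(_ (dr p r bot)) := a2; rewrite !ffunE.
    have [j ->] : exists j, i = size z1 + j by exists (i - size z1); rewrite subnKC // ltnW.
    rewrite drop_catr sz1 drop_catr; case: j => [|j] /=; last exact: R2.
    have /ffunP/(_ (dr q0 r bot)) := a2; rewrite !ffunE /= kr => ->; exact: erf.
- move=> [z e] [z0 e0] k [z' e'] [z0' e0'] k' [x [y [/= -> cxy w0 [Y' eY] [-> ->]]]].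
  move=> [x' [y' [/= -> cxy' w0' [Y'' eY'] [-> ->]]]] [a0 p0] [a0' p0'] [aa ee].
  move=> [[/= szx szy] ay] [/= _ R0]; rewrite {Y'' eY'}; subst e' e; split=> //=.
  rewrite p0 in R0; by apply: Rw_loop => //; rewrite a0' aa.
Qed.

(** * Stacks pushed by ascending words *)

Notation edge := (Gam * Q)%type.

(* [x] and [y] hold a stack symbol and the state right after it was pushed. *)
Definition link : rel edge :=
  fun x y => `[< exists w a, [/\ wn w, kind a = Call & dc (act w x.2) a = y] >].

Definition stk (pi : seq edge) : seq Gam := rev (map fst pi).

Lemma stk_cat pi tau : stk (pi ++ tau) = stk tau ++ stk pi.
Proof. by rewrite /stk map_cat rev_cat. Qed.

Lemma size_stk pi : size (stk pi) = size pi.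
Proof. by rewrite size_rev size_map. Qed.

(** [pi] collects the pushes of [Y] that are never popped, [w] stands for the well-matched stretch
    after the last of them. *)
Definition traces (x : edge) Y pi w :=
  [/\ path link x pi, wn w & run ([::], x.2) Y = (stk pi, act w (last x pi).2)].

Lemma traces_wn x v Y pi w : wn v -> traces (x.1, act v x.2) Y pi w ->
  exists w', traces x (v ++ Y) pi w'.
Proof.
move=> wv [/= Hp ww E]; case: pi Hp E => [|e pi] /= Hp E.
  exists (v ++ w); split=> //=; first exact: wn_cat.
  by rewrite run_cat (wn_run _ _ wv) E act_cat //; apply: wn_desc.
exists w; split=> //=; last by rewrite run_cat (wn_run _ _ wv) E.
case/andP: Hp => /asboolP[w1 [a [w1w ka Ee]]] ->; rewrite andbT.
apply/asboolP; exists (v ++ w1), a; split=> //; first exact: wn_cat.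
by rewrite act_cat //; apply: wn_desc.
Qed.

Lemma call_run p a g q Y : kind a = Call -> dc p a = (g, q) -> asc Y ->
  run ([::], p) (a :: Y) = ((run ([::], q) Y).1 ++ [:: g], (run ([::], q) Y).2).
Proof.
move=> ka Ed /ascP[k Hk] /=; rewrite ka Ed.
by have [] := @run_frame [::] [:: g] q Y k Hk.
Qed.

Lemma asc_traces x Y : asc Y -> exists pi w, traces x Y pi w.
Proof.
move: {2}(size Y) (leqnn (size Y)) => n; elim: n x Y => [|n IH] x Y.
  rewrite leqn0 => /eqP/size0nil -> _; exists [::], [::]; split=> //=.
  by rewrite ffunE.
move=> szY aY; have := asc_cases aY.
case=> [->|[a [Y1 [EY ka E]]]|[a [Y1 [EY ka aY1 _]]]|[c [z [r [Y1 [EY kc kr wz E]]]]]].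
- by exists [::], [::]; split=> //=; rewrite ffunE.
- have [||pi [w Hpi]] := IH (x.1, act [:: a] x.2) Y1; first by rewrite EY in szY.
    by rewrite /asc -E.
  have [|w' ?] := traces_wn _ Hpi; first by rewrite /wn /= ka.
  by exists pi, w'; rewrite EY.
- case Ed: (dc x.2 a) => [g q]; have [||pi [w [Hp ww Er]]] := IH (g, q) Y1 => //.
    by rewrite EY in szY.
  exists ((g, q) :: pi), w; split=> //=.
    rewrite Hp andbT; apply/asboolP; exists [::], a; split=> //.
    by rewrite ffunE.
  by rewrite EY (call_run ka Ed aY1) Er /= /stk /= rev_cons cats1.
- have [||pi [w Hpi]] := IH (x.1, act (c :: z ++ [:: r]) x.2) Y1.
  + by rewrite EY /= size_cat /= in szY; lia.
  + by rewrite /asc -E.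
  have [|w' H] := traces_wn _ Hpi; first by rewrite /wn dep1_cat.
  by exists pi, w'; move: H; rewrite EY /= -catA.
Qed.

Lemma fin_bound (I : finType) (P : I -> nat -> Prop) :
  (forall i, exists n, P i n) -> exists N, forall i, exists2 n, n <= N & P i n.
Proof.
move=> /choice[f fP]; exists (\max_i f i) => i; exists (f i) => //.
exact: leq_bigmax.
Qed.

(** Each link and the final stretch depend on a pair from a finite set, so they have realizations of
    bounded length. *)
Lemma traces_word : exists C, forall x pi w, path link x pi -> wn w ->
  exists Y, [/\ size Y <= C * (size pi).+1, asc Y &
                run ([::], x.2) Y = (stk pi, act w (last x pi).2)].
Proof.
have [N1 H1] : exists N, forall p : edge * edge, exists2 n, n <= N & link p.1 p.2 ->
    exists w a, [/\ size w = n, wn w, kind a = Call & dc (act w p.1.2) a = p.2].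
  apply: fin_bound => -[x y]; have [/asboolP[w [a [ww ka E]]]|nl] := boolP (link x y).
    by exists (size w) => _; exists w, a.
  by exists 0 => l; case/negP: nl.
have [N2 H2] : exists N, forall p : Q * Q, exists2 n, n <= N & (exists2 w, wn w & act w p.1 = p.2) ->
    exists w, [/\ size w = n, wn w & act w p.1 = p.2].
  apply: fin_bound => -[q s].
  have [[w ww E]|no] := pselect (exists2 w, wn w & act w q = s).
    by exists (size w) => _; exists w.
  by exists 0.
exists (N1 + N2).+1 => x pi w Hp ww; elim: pi x Hp => [|e pi IH] x /=.
  have [n nN [|w' [szw' ww' E]]] := H2 (x.2, act w x.2); first by exists w.
  move=> _; exists w'; split; [by rewrite szw'; lia | exact: wn_asc|].
  by rewrite (wn_run _ _ ww') E.
case/andP=> xe Hp; have [Y [szY aY E]] := IH e Hp.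
have [n nN [//|w' [a [szw' ww' ka Ed]]]] := H1 (x, e).
exists (w' ++ a :: Y); split.
- by rewrite size_cat /= szw'; nia.
- case/ascP: aY => k Hk; rewrite /asc dep_cat ww' /= ka.
  by have := dep_add 1 Hk; rewrite add0n => ->.
- rewrite run_cat (wn_run _ _ ww') (call_run ka (g := e.1) (q := e.2)) //; last first.
    by rewrite Ed; case: (e).
  by rewrite E /stk /= rev_cons cats1.
Qed.

(** * Lexicographic order on sequences of equal length *)

Section Lex.
Variable T : finType.
Implicit Types s t : seq T.

Fixpoint lexlt s t :=
  match s, t with
  | x :: s', y :: t' => (enum_rank x < enum_rank y) || ((x == y) && lexlt s' t')
  | _, _ => false
  end.

Lemma lexlt_cat a b s t : size a = size b ->
  lexlt (a ++ s) (b ++ t) = lexlt a b || ((a == b) && lexlt s t).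
Proof.
elim: a b => [|x a IH] [|y b] //= [/IH->]; rewrite eqseq_cons.
by case: (x == y) => //=; rewrite ?orbF ?orbA.
Qed.

Lemma lexlt_total s t : size s = size t -> s <> t -> lexlt s t \/ lexlt t s.
Proof.
elim: s t => [|x s IH] [|y t] //= [sz] ne.
have [Exy|nxy] := eqVneq x y.
  by rewrite -Exy ltnn /=; apply: IH => // Est; apply: ne; rewrite Exy Est.
have : enum_rank x != enum_rank y :> nat.
  by apply: contra nxy => /eqP/val_inj/enum_rank_inj ->.
by rewrite neq_ltn => /orP[]->; [left | right].
Qed.

Lemma lex_min k (P : seq T -> Prop) : (exists2 s, size s = k & P s) ->
  exists s, [/\ size s = k, P s & forall t, size t = k -> P t -> ~~ lexlt t s].
Proof.
elim: k P => [|k IH] P [s sz Ps].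
  by exists s; rewrite (size0nil sz) in Ps *; split=> // t /size0nil ->.
pose Q0 x := `[< exists2 s, size s = k & P (x :: s) >].
case: s sz Ps => // x0 s [sz] Ps.
have Q00 : Q0 x0 by apply/asboolP; exists s.
case: (arg_minnP (fun x : T => enum_rank x : nat) Q00) => x /asboolP/IH[s' [sz' Ps' mins']] minx.
exists (x :: s'); split=> //=; first by rewrite sz'.
case=> // y t [szt] Pyt /=; rewrite negb_or -leqNgt minx /=; last by apply/asboolP; exists t.
by have [Eyx|//] := eqVneq y x; rewrite Eyx in Pyt; apply: mins'.
Qed.

End Lex.

(** * Lexicographically least stacks *)

Section Stacks.
Variables (u : word) (fs : Q).
Let alpha := (st u).1.
Let x0 : edge := (bot, (st u).2).
Implicit Types pi tau : seq edge.

Definition cfg_of pi : cfg := (stk pi ++ alpha, fs).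
Definition pth pi := path link x0 pi.
Definition fin (x : edge) := exists2 w, wn w & act w x.2 = fs.
Definition cbase pi' pi := base (stk pi' ++ alpha) (stk pi ++ alpha).

(** Competitors have the same length, which keeps the two stacks aligned as [ceq_base] requires. *)
Definition rep pi := [/\ pth pi, fin (last x0 pi) &
  forall pi', pth pi' -> size pi' = size pi -> lexlt pi' pi -> fin (last x0 pi') ->
    ~ ceq (cfg_of pi') (cfg_of pi)].

(* Finite information on [pi] that decides which extensions of [pi] are least. *)
Definition smaller pi : {set edge * {set Q * Q}} :=
  [set y | `[< exists pi', [/\ pth pi', size pi' = size pi, lexlt pi' pi &
                                y = (last x0 pi', cbase pi' pi)] >]].
Definition plab pi := (last x0 pi, cbase pi pi, smaller pi).

Lemma cbase_cat pi' pi pi2' pi2 tau' tau : cbase pi' pi = cbase pi2' pi2 ->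
  size tau' = size tau -> cbase (pi' ++ tau') (pi ++ tau) = cbase (pi2' ++ tau') (pi2 ++ tau).
Proof.
move=> B sz; apply/setP=> -[q q']; rewrite /cbase !stk_cat -!catA.
by apply/baseP/baseP; apply: ceq_base; rewrite ?size_stk.
Qed.

Lemma pth_cat pi tau : pth (pi ++ tau) = pth pi && path link (last x0 pi) tau.
Proof. exact: cat_path. Qed.

(** A smaller path is either already smaller on the length of [pi], and this part is exchanged by
    means of the label, or it agrees with [pi] there and only its end counts. *)
Lemma smaller_cat pi pi2 tau y : plab pi = plab pi2 -> pth pi2 ->
  y \in smaller (pi ++ tau) -> y \in smaller (pi2 ++ tau).
Proof.
case=> El EB Es Hp2; rewrite 2!inE => /asboolP[b [Hb szb ltb ->]]; apply/asboolP.
pose b1 := take (size pi) b; pose b2 := drop (size pi) b.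
have Eb : b = b1 ++ b2 by rewrite cat_take_drop.
have sz1 : size b1 = size pi by rewrite size_takel // szb size_cat leq_addr.
have sz2 : size b2 = size tau by rewrite size_drop szb size_cat addKn.
move: Hb ltb; rewrite Eb pth_cat lexlt_cat // => /andP[Hb1 Hb2] /orP[lt1|/andP[/eqP Eb1 lt2]].
  have : (last x0 b1, cbase b1 pi) \in smaller pi2.
    by rewrite -Es inE; apply/asboolP; exists b1.
  rewrite inE => /asboolP[b1' [Hb1' szb1' ltb1' [El1 EB1]]].
  exists (b1' ++ b2); split.
  - by rewrite pth_cat Hb1' -El1.
  - by rewrite !size_cat szb1' sz2.
  - by rewrite lexlt_cat // ltb1'.
  - by rewrite !last_cat El1; congr (_, _); apply: cbase_cat.
rewrite Eb1 in Hb1 Hb2 *; exists (pi2 ++ b2); split.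
- by rewrite pth_cat Hp2 -El.
- by rewrite !size_cat sz2.
- by rewrite lexlt_cat // eqxx lt2 orbT.
- by rewrite !last_cat El; congr (_, _); apply: cbase_cat.
Qed.

(** On paths, [plab] is a right congruence with finitely many classes; with [rep_plab] this makes
    the least stacks a regular set. *)
Lemma plab_cat pi pi2 tau : plab pi = plab pi2 -> pth pi -> pth pi2 ->
  plab (pi ++ tau) = plab (pi2 ++ tau).
Proof.
move=> E Hp Hp2; rewrite /plab !last_cat; case: (E) => El EB _.
rewrite El (cbase_cat EB) //; congr (_, _, _).
by apply/setP=> y; apply/idP/idP; apply: smaller_cat.
Qed.

Lemma rep_plab pi pi2 : plab pi = plab pi2 -> pth pi2 -> rep pi -> rep pi2.
Proof.
case=> El _ Es Hp2 [Hp Hf Hmin]; split=> //; first by rewrite -El.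
move=> b Hb szb ltb Hfb Hceq.
have : (last x0 b, cbase b pi2) \in smaller pi.
  by rewrite Es inE; apply/asboolP; exists b.
rewrite inE => /asboolP[b' [Hb' szb' ltb' [El' EB']]].
apply: (Hmin b') => //; first by rewrite -El'.
by apply/baseP; rewrite -/(cbase b' pi) -EB'; apply/baseP.
Qed.

Lemma rep_inj pi pi' : rep pi -> rep pi' -> size pi = size pi' ->
  ceq (cfg_of pi) (cfg_of pi') -> pi = pi'.
Proof.
move=> [Hp Hf Hmin] [Hp' Hf' Hmin'] sz Hc; apply: contrapT => ne.
have [lt|lt] := lexlt_total sz ne; first exact: Hmin' Hc.
exact: Hmin (ceq_sym Hc).
Qed.

(** Two different loops could be concatenated along bit strings. All results would be least stacks,
    hence inequivalent at equal length, and [traces_word] realizes them by words of linear length,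
    against [collision]. *)
Lemma rep_loop pi tau tau' tau2 : size tau = size tau' ->
  pth (pi ++ tau) -> plab (pi ++ tau) = plab pi ->
  pth (pi ++ tau') -> plab (pi ++ tau') = plab pi ->
  rep (pi ++ tau ++ tau2) -> tau = tau'.
Proof.
move=> sz Hp Hl Hp' Hl' Hrep; apply: contrapT => ne.
have [C HC] := traces_word.
pose G := fun bs => flatten [seq (if b then tau else tau') | b <- bs].
have Hpi : pth pi by move: Hp; rewrite pth_cat => /andP[].
have G_loop bs : pth (pi ++ G bs) /\ plab (pi ++ G bs) = plab pi.
  elim: bs => [|b bs [IH1 IH2]]; first by rewrite cats0.
  have [Hpb Hlb] : pth (pi ++ (if b then tau else tau')) /\
      plab (pi ++ (if b then tau else tau')) = plab pi by case: b.
  rewrite [G _]/(_ ++ G bs) catA; rewrite (plab_cat _ Hlb) //; split=> //.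
  case: (Hlb) => El _ _; rewrite pth_cat Hpb El.
  by move: IH1; rewrite pth_cat => /andP[].
have [Hfull _ _] := Hrep.
have repG bs : rep (pi ++ G bs ++ tau2).
  have [H1 H2] := G_loop bs; have E : plab (pi ++ G bs) = plab (pi ++ tau) by rewrite H2.
  rewrite catA; apply: (rep_plab (pi := (pi ++ tau) ++ tau2)); last by rewrite -catA.
    by apply: plab_cat.
  case: (E) => El _ _; rewrite pth_cat H1 El.
  by move: Hfull; rewrite catA pth_cat => /andP[].
have /choice[g gP] : forall bs, exists Y,
    size Y <= C * (size (pi ++ G bs ++ tau2)).+1 /\ st (u ++ Y) = cfg_of (pi ++ G bs ++ tau2).
  move=> bs; have [Hpb [w ww Ew] _] := repG bs.
  have [Y [szY /ascP[k Hk] EY]] := HC _ _ w Hpb ww; exists Y; split=> //.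
  rewrite st_cat (surjective_pairing (st u)) -[(st u).1]cat0s.
  by rewrite (@run_frame [::] _ _ _ k Hk).1 EY /= Ew.
have szG bs : size (G bs) = size bs * size tau.
  by elim: bs => //= b bs IH; rewrite [G _]/(_ ++ G bs) size_cat IH; case: b; rewrite -?sz.
have [|bs [bs' [szb neb Hb]]] := @collision (C * size tau)
    (size u + C * (size pi + size tau2).+1) (fun bs => u ++ g bs).
  by move=> bs; rewrite size_cat; have [] := gP bs; rewrite !size_cat szG; lia.
have := Hb 0; rewrite !drop0 (gP bs).2 (gP bs').2 => /rep_inj -/(_ (repG _) (repG _)).
rewrite !size_cat !szG szb => /(_ erefl)/eqP.
rewrite eqseq_cat // eqxx eqseq_cat ?szG ?szb // eqxx andbT /= => /eqP EG.
apply: neb; elim: bs bs' szb EG {Hb} => [|b bs IH] [|b' bs'] //= [szb] /eqP.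
rewrite ![G (_ :: _)]/(_ ++ G _) eqseq_cat; last by case: b; case: b'.
case/andP=> /eqP Eb /eqP/(IH _ szb) ->; congr (_ :: _).
by move: Eb; case: b; case: b' => // E; case: ne.
Qed.

(** The trees are prefixes of least stacks, which need not satisfy [rep] themselves. *)
Definition useful pi := exists tau, rep (pi ++ tau).

Definition nodeP pi (d : option edge) (o1 o2 : option (seq edge)) :=
  [/\ useful pi, o2 = None &
      [/\ pi = [::], d = None & o1 = None] \/
      exists pi' e, [/\ pi = rcons pi' e, d = Some e & o1 = Some pi']].

Definition descP pi pi0 k := [/\ useful pi, useful pi0 & exists2 tau, pi = pi0 ++ tau & k = size tau].

Lemma pol_rep : pol rep size eq.
Proof.
have polT : pol (tree plab nodeP setT) size eq.
  apply: (pol_tree (desc := descP) (pol_fin (fun=> True) (fun=> 0)) (pol_nat (fun=> True))) => //.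
  - move=> pi d o1 o2 [_ -> [[-> _ ->]|[pi' [e [-> _ ->]]]]]; split=> //=.
    by rewrite size_rcons.
  - by move=> pi pi0 k [_ _ [tau -> ->]]; split=> //; rewrite size_cat ?leq_addr ?leq_addl.
  - by move=> pi d o1 o2 [Hu _ _]; exists 0; split=> //; exists [::]; rewrite ?cats0.
  - move=> pi d y o2 pi0 k [Hu _ [[]|[pi' [e [E _ [Ey]]]]]] // [_ Hu0 [tau E' _]].
    exists (size (rcons tau e)); split=> //; exists (rcons tau e) => //.
    by rewrite E -Ey E' rcons_cat.
  - by move=> pi d y o1 pi0 k [].
  - move=> pi d o1 o2 pi' d' o1' o2' [_ _ H] [_ _ H'] _ Ed.
    case: H H' Ed => [[-> -> ->]|[p1 [e [-> -> ->]]]] [[-> -> ->]|[p1' [e' [-> -> ->]]]] //=.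
    by move=> [->] ->.
  - move=> pi pi0 k pi' pi0' k' [[tau2 Hrep] _ [tau E Ek]] [[tau2' [Hrep' _ _]] _ [tau' E' Ek']].
    move=> L1 L2 L3 Ekk E0; subst pi pi' k k' pi0'; congr (_ ++ _).
    have Hp : pth (pi0 ++ tau) by case: Hrep; rewrite pth_cat => /andP[].
    have Hp' : pth (pi0 ++ tau') by move: Hrep'; rewrite pth_cat => /andP[].
    by apply: (@rep_loop pi0 tau tau' tau2); rewrite ?catA // L3 L1.
apply: pol_sub polT => // pi Hrep.
have : useful pi by exists [::]; rewrite cats0.
elim/last_ind: pi {Hrep} => [|pi e IH] Hu.
  by apply: (@Tree _ _ _ _ _ _ _ None None None) => //; split=> //; left.
apply: (@Tree _ _ _ _ _ _ _ (Some e) (Some pi) None) => //.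
  by split=> //; right; exists pi, e.
move=> _ [<-]; apply: IH; case: Hu => tau; rewrite -cats1 -catA => Hrep.
by exists ([:: e] ++ tau).
Qed.

End Stacks.

(** The class is given by the final state and the least path, which is as long as the stack that [Y]
    pushes and so at most [size Y]. *)
Lemma pol_ceq u : pol asc size (fun Y Y' => ceq (st (u ++ Y)) (st (u ++ Y'))).
Proof.
pose dec Y (p : Q * seq edge) := ceq (st (u ++ Y)) (cfg_of u p.1 p.2).
apply: (pol_pull (dec := dec) (pol_fam (fun fs => pol_rep u fs))) => [Y aY|]; last first.
  move=> Y Y' [fs pi] [fs' pi'] _ _ /= d d' [/= Ef Ep]; rewrite -Ef -Ep in d'.
  exact: ceq_trans d (ceq_sym d').
have [pi [w [Hp ww E]]] := asc_traces (bot, (st u).2) aY.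
pose fs := act w (last (bot, (st u).2) pi).2.
have [k Hk] := ascP aY; rewrite /= in E.
have EY : st (u ++ Y) = cfg_of u fs pi.
  rewrite st_cat (surjective_pairing (st u)) -[(st u).1]cat0s.
  by rewrite (@run_frame [::] _ _ _ k Hk).1 E.
have szpi : size pi = k.
  by have [_] := @run_frame [::] [::] (st u).2 Y k Hk; rewrite E /= size_stk.
have [|pi' [szpi' [Hp' Hf' Hc'] minpi']] := @lex_min _ k (fun pi' =>
    [/\ pth u pi', fin fs (last (bot, (st u).2) pi') & ceq (cfg_of u fs pi) (cfg_of u fs pi')]).
  by exists pi => //; split=> //; exists w.
exists (fs, pi'); split=> /=.
- split=> // b Hb szb ltb Hfb Hc; have := minpi' b; rewrite ltb szb.
  move=> /(_ szpi') H; have // : ~~ true.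
  by apply: H; split=> //; apply: ceq_trans Hc' (ceq_sym Hc).
- by rewrite szpi'; apply: dep_le Hk.
- by rewrite /dec EY.
Qed.

(** * Ascending words *)

Definition eq2 (Y Y' : word) := forall u, ceq (st (u ++ Y)) (st (u ++ Y')).

Lemma run_asc s p Y k : dep 0 Y = Some k ->
  run (s, p) Y = ((run ([::], p) Y).1 ++ s, (run ([::], p) Y).2) /\
  size (run ([::], p) Y).1 = k.
Proof. exact: (@run_frame [::]). Qed.

Lemma pol_eq2 : pol asc size eq2.
Proof.
(* By [ceq_base], [u] matters only through this finite tag once both words reach the same height. *)
pose tag u := (base (st u).1 (st u).1, (st u).2).
pose R t Y Y' := dep 0 Y = dep 0 Y' -> forall u, tag u = t -> ceq (st (u ++ Y)) (st (u ++ Y')).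
have polR t : pol asc size (R t).
  have [[u0 Eu0]|no] := pselect (exists u0, tag u0 = t); last first.
    exists 0 => n; exists unit, (fun=> tt); split; first by rewrite card_unit.
    by move=> Y Y' _ _ _ _ _ _ u Eu; case: no; exists u.
  apply: pol_sub (pol_ceq u0) => // Y Y' /ascP[k Hk] /ascP[k' Hk'].
  rewrite !st_cat => H Ekk u Eu; move: Ekk; rewrite Hk Hk' => -[Ekk].
  move: Eu0; rewrite -Eu => -[EB Eq]; rewrite !st_cat; move: H.
  move: (st u0) (st u) EB Eq => [a0 p0] [a p] /= EB Eq; rewrite {}Eq.
  have [-> sz] := run_asc a0 p Hk; have [-> sz'] := run_asc a0 p Hk'.
  have [-> _] := run_asc a p Hk; have [-> _] := run_asc a p Hk'.
  by apply: ceq_base => //; rewrite sz sz' Ekk.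
apply: (pol_pull (dec := fun Y (p : nat * word) => dep 0 Y = Some p.1 /\ p.2 = Y)
          (pol_prod (pol_nat (fun=> True)) (pol_all polR))).
  move=> Y aY; have [k Hk] := ascP aY; exists (k, Y); split=> //=.
  by rewrite geq_max leqnn andbT; apply: dep_le Hk.
move=> Y Y' [k Y1] [k' Y1'] _ _ [/= Hk ->] [/= Hk' ->] [/= Ekk H] u.
by apply: (H (tag u)) => //; rewrite Hk Hk' Ekk.
Qed.

(* By [ceq_base], this finite set determines which pairs of configurations
   become equivalent after reading [Y]. *)
Definition tlab (Y : word) : {set Q * Q * {set Q * Q}} :=
  [set t | `[< exists b b', base b b' = t.2 /\ ceq (run (b, t.1.1) Y) (run (b', t.1.2) Y) >]].

Definition kle (Y Y' : word) := forall c c', ceq (run c Y) (run c' Y) -> ceq (run c Y') (run c' Y').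

Lemma kle_trans Y2 Y1 Y3 : kle Y1 Y2 -> kle Y2 Y3 -> kle Y1 Y3.
Proof. by move=> H1 H2 c c' /H1/H2. Qed.

Lemma kle_cat l Y Y' : kle Y Y' -> kle (l ++ Y) (l ++ Y').
Proof. by move=> H c c'; rewrite !run_cat; apply: H. Qed.

Lemma tlab_kle Y Y' : asc Y' -> tlab Y = tlab Y' -> kle Y Y'.
Proof.
move=> /ascP[k Hk] E [b p] [b' p'] H.
have : (p, p', base b b') \in tlab Y by rewrite inE; apply/asboolP; exists b, b'.
rewrite E inE => /asboolP[b2 [b2' [/= B]]].
have [-> sz] := run_asc b2 p Hk; have [-> sz'] := run_asc b2' p' Hk.
have [-> _] := run_asc b p Hk; have [-> _] := run_asc b' p' Hk.
by apply: ceq_base => //; rewrite sz sz'.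
Qed.

(* Concatenating two different loops in all possible ways gives exponentially
   many windows, told apart by the rightmost position where they differ. *)
Lemma loop_collision (l : bool -> word) Y : size (l true) = size (l false) ->
  (forall b, kle (l b ++ Y) Y) ->
  forall i, i <= size (l true) -> ceq (st (drop i (l true) ++ Y)) (st (drop i (l false) ++ Y)).
Proof.
move=> szl loop.
(* The head of a bit string is the rightmost loop, so induction on the string meets the rightmost
   difference first. *)
pose pre := fix pre s := if s is b :: s' then pre s' ++ l b else [::].
have preE b s : pre (b :: s) = pre s ++ l b by [].
have szlb b : size (l b) = size (l true) by case: b.
have size_pre s : size (pre s) = size s * size (l true).
  by elim: s => // b s IH; rewrite preE size_cat IH szlb /=; lia.
have [|s [s' [szs ss' Hs]]] := collision (a := size (l true)) (b := size Y)
    (g := fun s => pre s ++ Y).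
  by move=> s; rewrite size_cat size_pre; lia.
have {s s' szs ss' Hs} [b [b' [bb' Hl]]] : exists b b', b != b' /\
    forall i, i <= size (l b) -> ceq (st (drop i (l b) ++ Y)) (st (drop i (l b') ++ Y)).
  (* Common loops on the right move into [Y']; configurations identified by [Y'] are identified by
     [Y] as well. *)
  have [Y' EY kY'] : exists2 Y', Y' = Y & kle Y' Y by exists Y.
  rewrite -{}EY in Hs; elim: s s' szs ss' Y' kY' Hs => [|b s IH] [|b' s'] // [szs] ss' Y' kY' Hs.
  have [bb'|bb'] := eqVneq b b'.
    rewrite -bb' in Hs ss'; apply: (IH s' szs _ (l b ++ Y')).
    - by move=> E; apply: ss'; rewrite E.
    - by apply: kle_trans (loop b); apply: kle_cat.
    - by move=> i; have := Hs i; rewrite !preE -!catA.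
  exists b, b'; split=> // i hi; have := Hs (size (pre s) + i).
  rewrite !preE -!catA drop_catr size_pre szs -size_pre drop_catr.
  rewrite !drop_catl //; last by rewrite szlb -(szlb b).
  by rewrite !st_cat; apply: kY'.
rewrite szlb in Hl; case: b b' bb' Hl => -[] // _ Hl i hi.
by apply: ceq_sym; apply: Hl.
Qed.

(** [eq2] allows the exchange of the words behind any text, the last clause is for windows cut
    inside them. *)
Definition Ra (Y Y' : word) :=
  [/\ size Y = size Y', eq2 Y Y' & forall i, ceq (st (drop i Y)) (st (drop i Y'))].

Lemma Ra_loop l l' Y Y' : size l = size l' -> asc Y -> asc Y' -> asc (l ++ Y) -> asc (l' ++ Y') ->
  tlab (l ++ Y) = tlab Y -> tlab (l' ++ Y') = tlab Y' -> tlab Y = tlab Y' ->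
  eq2 (l ++ Y) (l' ++ Y') -> Ra Y Y' -> Ra (l ++ Y) (l' ++ Y').
Proof.
move=> szl aY aY' alY alY' E1 E2 E E2l [szY E2Y sfx].
split=> // [|i]; first by rewrite !size_cat szl szY.
have [hi|hi] := leqP i (size l); last first.
  have [j ->] : exists j, i = size l + j by exists (i - size l); rewrite subnKC // ltnW.
  by rewrite drop_catr szl drop_catr.
(* [Y'] is exchanged for [Y] by [eq2], so that both loops stand in front of the same word. *)
rewrite !drop_catl -?szl //; apply: ceq_trans (E2Y _).
apply: (@loop_collision (fun b => if b then l else l')) => // -[].
  exact: tlab_kle.
apply: (@kle_trans (l' ++ Y')); first by apply/kle_cat/tlab_kle.
by apply: tlab_kle => //; rewrite E2.
Qed.

(** Root letters, and the kernel of the text after the block enclosed by a matched pair; without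
    such a pair [nodeA] fills in [ker [::]] and the empty block. *)
Definition blk_tag := (option Sigma * option Sigma * {set Q * Q})%type.

Definition nodeA (Y : word) (d : blk_tag * word) (o1 o2 : option word) :=
  [/\ asc Y, o2 = None &
   [\/ [/\ Y = [::], d = (None, None, ker [::], [::]) & o1 = None],
       exists a Y1, [/\ Y = a :: Y1, asc Y1, d = (Some a, None, ker [::], [::]) & o1 = Some Y1] |
       exists c z r Y1, [/\ Y = c :: z ++ r :: Y1, [/\ kind c = Call, kind r = Ret, wn z & asc Y1],
                            d = (Some c, Some r, ker (r :: Y1), z) & o1 = Some Y1]]].

(** In place of the loop [l] the datum keeps the whole word, which [pol_asc] compares up to [eq2]
    only, and the length of [l]. *)
Definition descA (Y Y0 : word) (k : word * nat) :=
  [/\ asc Y, asc Y0 & exists2 l, Y = l ++ Y0 & k = (Y, size l)].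

Lemma run_matched c a z z' y : kind a = Call -> wn z -> wn z' -> act z = act z' ->
  run c (a :: z ++ y) = run c (a :: z' ++ y).
Proof.
move=> ka wz wz' E; case: c => s p /=; rewrite ka; case: (dc p a) => g q.
by rewrite !run_cat (wn_run _ _ wz) (wn_run _ _ wz') E.
Qed.

Lemma eq2_cat x Y Y' : eq2 Y Y' -> eq2 (x ++ Y) (x ++ Y').
Proof. by move=> H u; rewrite !catA. Qed.

Lemma Ra_letter a Y Y' : Ra Y Y' -> Ra (a :: Y) (a :: Y').
Proof.
move=> [szY E2 sfx]; have E2a : eq2 (a :: Y) (a :: Y') by apply: (@eq2_cat [:: a]).
by split=> //= [|[|i]]; [rewrite szY | rewrite !drop0; apply: (E2a [::]) | apply: sfx].
Qed.

(** A suffix starting inside the block is judged by the kernel of the text after it; later suffixes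
    are inherited from [r :: Y]. *)
Lemma Ra_matched c z z' r Y Y' : kind c = Call -> kind r = Ret -> wn z -> wn z' ->
  Rw (ker (r :: Y)) z z' -> Ra Y Y' -> Ra (c :: z ++ r :: Y) (c :: z' ++ r :: Y').
Proof.
move=> kc kr wz wz' [az szz sfz] RY; have [szY E2 sfx] := RY.
have [_ E2r sfr] := Ra_letter r RY.
have E2c : eq2 (c :: z ++ r :: Y) (c :: z' ++ r :: Y').
  move=> u; rewrite st_cat (run_matched _ _ kc wz wz' az) -st_cat.
  exact: (@eq2_cat (c :: z')).
split=> //; first by rewrite /= !size_cat /= szz szY.
case=> [|i]; first by rewrite !drop0; apply: (E2c [::]).
rewrite /=; have [hi|hi] := leqP i (size z); last first.
  have [j ->] : exists j, i = size z + j by exists (i - size z); rewrite subnKC // ltnW.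
  by rewrite drop_catr szz drop_catr.
rewrite !drop_catl -?szz //; apply: ceq_trans (E2r _).
by rewrite !st_desc; try (by apply/desc_drop/wn_desc); apply/kerP/sfz.
Qed.

Lemma tree_asc Y : asc Y -> tree tlab nodeA setT Y.
Proof.
move: {2}(size Y) (leqnn (size Y)) => n; elim: n Y => [|n IH] Y.
  rewrite leqn0 => /eqP/size0nil -> _.
  by apply: (@Tree _ _ _ _ _ _ _ (None, None, ker [::], [::]) None None) => //;
    split=> //; constructor 1.
move=> szY aY; have := asc_cases aY.
case=> [EY|[a [Y1 [EY ka E]]]|[a [Y1 [EY ka aY1 _]]]|[c [z [r [Y1 [EY kc kr wz E]]]]]].
- by apply: (@Tree _ _ _ _ _ _ _ (None, None, ker [::], [::]) None None) => //;
    split=> //; constructor 1.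
- have aY1 : asc Y1 by rewrite /asc -E.
  apply: (@Tree _ _ _ _ _ _ _ (Some a, None, ker [::], [::]) (Some Y1) None) => //.
    by split=> //; constructor 2; exists a, Y1.
  by move=> _ [<-]; apply: IH => //; rewrite EY in szY.
- apply: (@Tree _ _ _ _ _ _ _ (Some a, None, ker [::], [::]) (Some Y1) None) => //.
    by split=> //; constructor 2; exists a, Y1.
  by move=> _ [<-]; apply: IH => //; rewrite EY in szY.
- have aY1 : asc Y1 by rewrite /asc -E.
  apply: (@Tree _ _ _ _ _ _ _ (Some c, Some r, ker (r :: Y1), z) (Some Y1) None) => //.
    by split=> //; constructor 3; exists c, z, r, Y1.
  by move=> _ [<-]; apply: IH => //; rewrite EY /= size_cat /= in szY; lia.
Qed.

Lemma pol_asc : pol asc size Ra.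
Proof.
pose PZ (t : blk_tag) z := (exists Y, t.2 = ker Y) /\ wn z.
have polZ (t : blk_tag) : pol (PZ t) size (Rw t.2).
  have [[Y EY]|no] := pselect (exists Y, t.2 = ker Y).
    by apply: pol_sub (pol_wn Y) => [z []|z z' _ _] //; rewrite EY.
  exists 0 => n; exists unit, (fun=> tt); split; first by rewrite card_unit.
  by move=> z z' [].
apply: pol_sub (@tree_asc) _ _ => [Y Y' _ _ H|]; first exact: H.
apply: (pol_tree (desc := descA) (pol_fam polZ) (pol_prod pol_eq2 (pol_nat (fun=> True)))).
- move=> Y d o1 o2 [aY -> [[-> -> ->]|[a [Y1 [-> _ -> ->]]]|[c [z [r [Y1 [-> [_ _ wz _] -> ->]]]]]]].
  + by split=> //; split=> //; exists [::].
  + by split=> //=; split=> //; exists [::].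
  + split=> //=; first by split=> //; exists (r :: Y1).
      by rewrite size_cat /=; lia.
    by rewrite size_cat /=; lia.
- move=> Y Y0 k [aY aY0 [l EY ->]]; rewrite {}EY in aY *; rewrite size_cat; split=> //=.
  + by rewrite geq_max leqnn leq_addr.
  + by rewrite leq_addl.
- by move=> Y d o1 o2 [aY _ _]; exists (Y, 0); split=> //; exists [::].
- move=> Y d Y1 o2 Y0 k [aY _ H] [_ aY0 [l E _]]; rewrite {}E in H.
  case: H => [[]|[a [Y1' [EY _ _ [E]]]]|[c [z [r [Y1' [EY _ _ [E]]]]]]] //; subst Y Y1'.
    by exists (a :: l ++ Y0, size (a :: l)); split=> //; exists (a :: l).
  exists (c :: z ++ r :: l ++ Y0, size (c :: z ++ r :: l)); split=> //.
  by exists (c :: z ++ r :: l) => //=; rewrite -catA.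
- by move=> Y d Y1 o1 Y0 k [].
- move=> Y d o1 o2 Y' d' o1' o2' [_ _ H] [_ _ H'] _ Ed Eo _.
  case: H H' Ed Eo => [[-> -> ->]|[a [Y1 [-> _ -> ->]]]|[c [z [r [Y1 [-> [kc kr wz _] -> ->]]]]]];
  case=> [[-> -> ->]|[a' [Y1' [-> _ -> ->]]]|[c' [z' [r' [Y1' [-> [_ _ wz' _] -> ->]]]]]] //=.
  + by case=> -[<-] _; apply: Ra_letter.
  + by case=> -[].
  + by case=> -[].
  + by case=> -[<- <- _] ? ?; apply: Ra_matched.
- move=> Y Y0 k Y' Y0' k' [aY aY0 [l EY ->]] [aY' aY0' [l' EY' ->]] E1 E2 E3 [/= Eeq Esz] R0.
  by rewrite EY EY' in aY aY' E1 E2 E3 Eeq *; apply: Ra_loop => //; rewrite ?E1 ?E2 ?E3.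
Qed.

Lemma dep_big h w : size w <= h -> dep h w.
Proof.
elim: w h => [|a w IH] h //= hw; case: (kind a).
- by apply: IH; lia.
- by case: h hw.
- by apply: IH; lia.
Qed.

(* Calls in front of a window turn it into an ascending word. *)
Lemma pol_words c : kind c = Call -> pol (fun=> True) size
  (fun w w' => size w = size w' /\ forall i, ceq (st (drop i w)) (st (drop i w'))).
Proof.
move=> kc; pose pad w := nseq (size w) c ++ w.
have asc_pad w : asc (pad w).
  rewrite /asc dep_cat; suff -> n h : dep h (nseq n c) = Some (h + n) by apply: dep_big.
  by elim: n h => [|n IH] h /=; rewrite ?addn0 // kc IH addSnnS.
apply: (pol_pull (dec := fun w (p : nat * word) => p = (size w, pad w))
          (pol_prod (pol_nat (fun=> True)) (pol_half pol_asc))).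
  move=> w _; exists (size w, pad w); split=> //=.
  by rewrite geq_max leqnn size_cat size_nseq addnn doubleK leqnn.
move=> w w' _ _ _ _ -> -> [/= Esz [_ _ sfx]]; split=> // i.
have := sfx (size w + i); rewrite /pad -Esz -{1 3}(size_nseq (size w) c) !drop_catr.
by [].
Qed.

End Vpa.

(** * The trichotomy *)

Lemma log2_sublinear C : exists N, forall n, N <= n -> C * log2 n <= n.
Proof.
(* The threshold gives [4 * C <= l], so [C * l] is at most a quarter of [l ^ 2], while
   [n >= 2 ^ l >= (l./2).+1 ^ 2]. *)
exists (2 ^ (4 * C)) => n Nn; pose l := log2 n.
have n0 : 0 < n by apply: leq_trans Nn; rewrite expn_gt0.
have l4 : 4 * C <= l by rewrite -(trunc_expnK (p := 2) (4 * C)) //; apply: leq_trunc_log.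
have ln : 2 ^ l <= n by apply: trunc_logP.
have sq : (l./2).+1 * (l./2).+1 <= n.
  apply: leq_trans ln; apply: (@leq_trans (2 ^ (l./2 + l./2))); last by rewrite leq_exp2l //; lia.
  by rewrite expnD leq_mul // ltn_expl.
by rewrite -/l; have := odd_double_half l; nia.
Qed.

Lemma bigO_log_littleo f : bigO_log f -> littleo_lin f.
Proof.
move=> [C [N HN]] k _; have [M HM] := log2_sublinear (k * C).
exists (N + M) => n Nn; apply: leq_trans (HM n _); last by lia.
by rewrite -mulnA leq_mul2l HN ?orbT //; lia.
Qed.

Lemma bigO1_log f : bigO1 f -> bigO_log f.
Proof.
move=> [C [N HN]]; exists C, (N + 2) => n Nn; apply: leq_trans (HN n _) _; first by lia.
by rewrite leq_pmulr // trunc_log_gt0; lia.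
Qed.

Lemma bigO1_not_Omega f : bigO1 f -> ~ bigOmega_log f.
Proof.
(* At [2 ^ m] the logarithm is [m], which exceeds [C' * C]. *)
move=> [C [N HN]] [C' [N' HN']]; pose m := N + N' + C' * C + 1.
have lt : m < 2 ^ m by apply: ltn_expl.
have := HN' (2 ^ m); rewrite /log2 trunc_expnK // => /(_ _)/leq_trans H.
have : m <= C' * C by apply: H; [lia | rewrite leq_mul2l HN ?orbT //; lia].
by rewrite /m; lia.
Qed.

Lemma VL_poly (Sigma : finType) (L : seq Sigma -> bool) V d : is_VL L V ->
  (forall n, exists (U : finType) (f : seq Sigma -> U), #|U| <= n.+2 ^ d /\
     forall w w', size w <= n -> size w' <= n -> f w = f w' -> weq L w w') ->
  bigO_log V.
Proof.
(* With [l = log2 n >= 1], [n.+2 <= (2 ^ l.+1) ^ 2] and [l.+1 * (2 * d) <= 4 * d * l]. *)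
move=> VL Hd; exists (4 * d), 2 => n n2; have [U [f [cU Hf]]] := Hd n.
apply: leq_trans (VL_upper VL Hf) _; pose l := log2 n.
have l0 : 0 < l by rewrite trunc_log_gt0.
have nl : n < 2 ^ l.+1 by apply: trunc_log_ltn.
rewrite -[leqRHS](trunc_expnK (p := 2)) //; apply: leq_trunc_log.
apply: leq_trans cU _; rewrite -/l; apply: (@leq_trans ((2 ^ l.+1) ^ (2 * d))).
  rewrite expnM; case: d {Hd} => // d; rewrite leq_exp2r //.
  by rewrite expnS expn1; nia.
by rewrite -expnM leq_exp2l //; nia.
Qed.

Lemma littleo_poly (Sigma : finType) (kind : Sigma -> letter_kind) (L : seq Sigma -> bool) V :
  (exists a, kind a = Call) -> is_vpl kind L -> is_VL L V -> littleo_lin V -> bigO_log V.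
Proof.
move=> [c kc] [Q [Gam [bot [q0 [dc [dr [di [F [_ LE]]]]]]]]] VL lo.
have LE' w : L w = F (st kind bot q0 dc dr di w).2 by rewrite LE.
have coll a b (g : seq bool -> seq Sigma) : (forall s, size (g s) <= a * size s + b) ->
    exists s s', [/\ size s = size s', s <> s' & forall i, ceq kind bot dc dr di F
      (st kind bot q0 dc dr di (drop i (g s))) (st kind bot q0 dc dr di (drop i (g s')))].
  move=> szg; have [s [s' [szs ne E]]] := littleo_collision VL lo szg.
  exists s, s'; split=> // i x; rewrite -!st_cat -!LE'.
  exact: weq_drop.
have [d Hd] := pol_words coll kc; apply: (VL_poly (d := d) VL) => n.
have [U [f [cU Hf]]] := Hd n; exists U, f; split=> // w w' sw sw' E.
have [szw sfx] := Hf w w' I I sw sw' E; apply: weq_suffixes => // i x.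
by rewrite !LE' !st_cat; apply: sfx.
Qed.

Theorem theorem1 (Sigma : finType) (kind : Sigma -> letter_kind)
    (L : seq Sigma -> bool) (V : nat -> nat) :
  (exists a : Sigma, kind a = Call) ->
  (exists b : Sigma, kind b = Ret) ->
  is_vpl kind L ->
  is_VL L V ->
  let P1 := bigO1 V in
  let P2 := bigTheta_log V in
  let P3 := bigO_lin V /\ ~ littleo_lin V in
  [\/ P1 /\ ~ P2 /\ ~ P3, ~ P1 /\ P2 /\ ~ P3 | ~ P1 /\ ~ P2 /\ P3].
Proof.
move=> call _ vpl VL P1 P2 P3.
have [b1|ub] := pselect (bigO1 V).
  constructor 1; split=> //; split; first by case=> _; apply: bigO1_not_Omega.
  by case=> _; apply; apply/bigO_log_littleo/bigO1_log.
have [lo|nlo] := pselect (littleo_lin V).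
  constructor 2; split=> //; split; last by case.
  by split; [apply: littleo_poly call vpl VL lo | apply: VL_log VL ub].
constructor 3; split=> //; split; last by split=> //; apply: VL_lin VL.
by case=> /bigO_log_littleo.
Qed.
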